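(* Let $\mathrm{E}$ be a Dedekind complete vector lattice, and let $\mathrm{M}_p$ be the set of those carriers of positive order continuous functionals on $\mathrm{E}$ which are perfect: $$\mathrm{M}_p=\{\mathrm{C}_\varphi : 0\le \varphi\in \mathrm{E}^\sim_{\mathrm n} \text{ and } \mathrm{C}_\varphi \text{ is perfect}\}\subseteq \mathbf{B}_{\mathrm{E}}.$$ The following statements are true. (i) $\mathrm{M}_p$ is an ideal in the Boolean algebra $\mathbf{B}_{\mathrm{E}}$. (ii) $P_{\mathrm{M}_p}:\mathrm{E}\to\varprojlim\mathcal{I}_{\mathrm{M}_p}$ is a lattice isomorphism if and only if $\mathrm{E}$ is perfect.
   Context: For a vector lattice $\mathrm{E}$, $\mathrm{E}^\sim$ is the vector lattice of order bounded linear functionals on $\mathrm{E}$, and $\mathrm{E}^\sim_{\mathrm n}$ is the sublattice of order continuous functionals ($\varphi$ is order continuous if $\inf|\varphi[A]|=0$ whenever $A\downarrow 0$, i.e. $A$ is downward directed with $\inf A=0$). $\mathrm{E}$ is perfect if the canonical map $\mathrm{E}\ni u\mapsto \Psi_u\in (\mathrm{E}^\sim_{\mathrm n})^\sim_{\mathrm n}$, $\Psi_u(\varphi)=\varphi(u)$, is a lattice isomorphism onto $(\mathrm{E}^\sim_{\mathrm n})^\sim_{\mathrm n}$. For $\varphi\in \mathrm{E}^\sim$, its null ideal is $\mathrm{N}_\varphi=\{u\in\mathrm{E}: |\varphi|(|u|)=0\}$ and its carrier is the band $\mathrm{C}_\varphi=\mathrm{N}_\varphi^d=\{u: |u|\wedge|v|=0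 \text{ for all } v\in \mathrm{N}_\varphi\}$. $\mathbf{B}_{\mathrm{E}}$ is the Boolean algebra of projection bands in $\mathrm{E}$, ordered by inclusion (for Dedekind complete $\mathrm{E}$, all bands are projection bands). An ideal in $\mathbf{B}_{\mathrm{E}}$ is a downward closed, upward directed subset. Given a collection $\mathrm{M}$ of projection bands in $\mathrm{E}$ that is upward directed under inclusion, let $P_{\mathrm B}:\mathrm{E}\to \mathrm B$ be the band projection onto $\mathrm B\in \mathrm{M}$. The inverse system $\mathcal{I}_{\mathrm{M}}$ consists of the bands $\mathrm B\in \mathrm{M}$ (indexed by inclusion) and, for $\mathrm A\subseteq \mathrm B$ in $\mathrm M$, the band projection $P_{\mathrm B,\mathrm A}=P_{\mathrm A}|_{\mathrm B}:\mathrm B\to \mathrm A$. Its inverse limit is $\varprojlim\mathcal{I}_{\mathrm{M}}=\{(u_{\mathrm B})\in\prod_{\mathrm B\in\mathrm{M}}\mathrm B : P_{\mathrm B,\mathrm A}(u_{\mathrm B})=u_{\mathrm A} \text{ whenever } \mathrm A\subseteq \mathrm B\}$, a sublattice of the product with coordinatewise operations, and $P_{\mathrm{M}}(u)=(P_{\mathrm B}(u))_{\mathrm B\in\mathrm{M}}$. *)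

(* Defs.v *)
From HB Require Import structures.
From mathcomp Require Import all_boot all_order all_algebra.
From mathcomp Require Import all_classical all_reals.

Set Implicit Arguments.
Unset Strict Implicit.
Unset Printing Implicit Defensive.

Import Order.TTheory GRing.Theory Num.Theory.

Local Open Scope classical_set_scope.
Local Open Scope ring_scope.

HB.mixin Record Lmodule_isVectorLattice (R : realType) E
    of GRing.Lmodule R E & Num.POrderedZmodule E := {
  vmeet : E -> E -> E ;
  vjoin : E -> E -> E ;
  vlexI : forall x y z : E, (z <= vmeet x y) = (z <= x) && (z <= y) ;
  vleUx : forall x y z : E, (vjoin x y <= z) = (x <= z) && (y <= z) ;
  vle_add2r : forall z x y : E, x <= y -> x + z <= y + z ;
  vscale_ge0 : forall (a : R) (x : E), 0 <= a -> 0 <= x -> 0 <= a *: x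
}.

(* The meet and join are fields of this structure rather than inherited from
   [Order.Lattice]: [Num.RealDomain] already joins [Order.Lattice ring_display]
   with [GRing.Zmodule], so Hierarchy Builder accepts no new structure doing
   the same. *)
#[short(type="vectorLatticeType")]
HB.structure Definition VectorLattice (R : realType) :=
  { E of GRing.Lmodule R E & Num.POrderedZmodule E
       & Lmodule_isVectorLattice R E }.

Definition vabs (R : realType) (E : vectorLatticeType R) (u : E) : E :=
  vjoin u (- u).

Definition vpos (R : realType) (E : vectorLatticeType R) (u : E) : E :=
  vjoin u 0.

Section VectorLatticeTheory.
Context {R : realType} {E : vectorLatticeType R}.
Implicit Types (x y z u v w : E) (a : R).

Lemma vleUl x y : x <= vjoin x y.
Proof. by have := lexx (vjoin x y); rewrite vleUx => /andP[]. Qed.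

Lemma vleUr x y : y <= vjoin x y.
Proof. by have := lexx (vjoin x y); rewrite vleUx => /andP[]. Qed.

Lemma vleIl x y : vmeet x y <= x.
Proof. by have := lexx (vmeet x y); rewrite vlexI => /andP[]. Qed.

Lemma vleIr x y : vmeet x y <= y.
Proof. by have := lexx (vmeet x y); rewrite vlexI => /andP[]. Qed.

Lemma vjoinC x y : vjoin x y = vjoin y x.
Proof. by apply/eqP; rewrite eq_le !vleUx !vleUl !vleUr. Qed.

Lemma vmeetC x y : vmeet x y = vmeet y x.
Proof. by apply/eqP; rewrite eq_le !vlexI !vleIl !vleIr. Qed.

Lemma vjoin_l x y : y <= x -> vjoin x y = x.
Proof. by move=> yx; apply/eqP; rewrite eq_le vleUl vleUx lexx yx. Qed.

Lemma vmeet_l x y : x <= y -> vmeet x y = x.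
Proof. by move=> xy; apply/eqP; rewrite eq_le vleIl vlexI lexx xy. Qed.

Lemma vleD2rE z x y : (x + z <= y + z) = (x <= y).
Proof.
apply/idP/idP; last exact: vle_add2r.
by move=> /(vle_add2r (- z)); rewrite !addrK.
Qed.

Lemma vleD2lE z x y : (z + x <= z + y) = (x <= y).
Proof. by rewrite ![z + _]addrC vleD2rE. Qed.

Lemma vleD x y u v : x <= y -> u <= v -> x + u <= y + v.
Proof.
by move=> xy uv; rewrite (@le_trans _ _ (y + u))// ?vleD2rE// vleD2lE.
Qed.

Lemma vsubr_ge0 x y : (0 <= y - x) = (x <= y).
Proof. by rewrite -(vleD2rE x 0) add0r subrK. Qed.

Lemma vleBlDr x y z : (x - y <= z) = (x <= z + y).
Proof. by rewrite -(vleD2rE y (x - y)) subrK. Qed.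

Lemma vleBrDr x y z : (x <= y - z) = (x + z <= y).
Proof. by rewrite -(vleD2rE z x) subrK. Qed.

Lemma vleN2 x y : (- x <= - y) = (y <= x).
Proof. by rewrite -[LHS]vsubr_ge0 opprK addrC vsubr_ge0. Qed.

Lemma voppr_le0 x : (- x <= 0) = (0 <= x).
Proof. by rewrite -{1}oppr0 vleN2. Qed.

Lemma vaddr_ge0 x y : 0 <= x -> 0 <= y -> 0 <= x + y.
Proof. by move=> x0 y0; rewrite -[0]addr0 vleD. Qed.

Lemma vler_wpDr x y z : 0 <= z -> x <= y -> x <= y + z.
Proof. by move=> z0 xy; rewrite -[x]addr0 vleD. Qed.

Lemma vler_scale a x y : 0 <= a -> x <= y -> a *: x <= a *: y.
Proof. by move=> a0 xy; rewrite -vsubr_ge0 -scalerBr vscale_ge0 ?vsubr_ge0. Qed.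

Lemma vler_scaler a (b : R) x : 0 <= x -> a <= b -> a *: x <= b *: x.
Proof. by move=> x0 ab; rewrite -vsubr_ge0 -scalerBl vscale_ge0 ?subr_ge0. Qed.

Lemma vjoinD2r z x y : vjoin x y + z = vjoin (x + z) (y + z).
Proof.
apply/eqP; rewrite eq_le vleUx !vleD2rE vleUl vleUr andbT.
by rewrite -vleBrDr vleUx !vleBrDr vleUl vleUr.
Qed.

Lemma voppU x y : - vjoin x y = vmeet (- x) (- y).
Proof.
apply/eqP; rewrite eq_le vlexI !vleN2 vleUl vleUr /=.
by rewrite -[X in X <= _]opprK vleN2 vleUx -![_ <= - vmeet _ _]vleN2 !opprK
  vleIl vleIr.
Qed.

Lemma voppI x y : - vmeet x y = vjoin (- x) (- y).
Proof. by rewrite -{1}(opprK x) -{1}(opprK y) -voppU opprK. Qed.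

Lemma vmeetD2r z x y : vmeet x y + z = vmeet (x + z) (y + z).
Proof. by apply: oppr_inj; rewrite voppI !opprD voppI vjoinD2r. Qed.

Lemma vmeetB x y : x - vmeet x y = vjoin 0 (x - y).
Proof. by rewrite voppI addrC vjoinD2r addNr [- y + x]addrC. Qed.

Lemma vpos_ge0 x : 0 <= vpos x. Proof. exact: vleUr. Qed.

Lemma vle_pos x : x <= vpos x. Proof. exact: vleUl. Qed.

Lemma vpos_id x : 0 <= x -> vpos x = x.
Proof. by move=> x0; exact: vjoin_l. Qed.

Lemma vposN x : vpos (- x) = vpos x - x.
Proof. by rewrite /vpos vjoinD2r subrr add0r vjoinC. Qed.

Lemma vposB x : vpos x - vpos (- x) = x.
Proof. by rewrite vposN opprB addrC subrK. Qed.

Lemma vjoinE x y : vjoin x y = vpos (x - y) + y.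
Proof. by rewrite /vpos vjoinD2r subrK add0r. Qed.

Lemma vle_abs x : x <= vabs x. Proof. exact: vleUl. Qed.

Lemma vle_absN x : - x <= vabs x. Proof. exact: vleUr. Qed.

Lemma vabsN x : vabs (- x) = vabs x.
Proof. by rewrite /vabs opprK vjoinC. Qed.

Lemma vabs_ge0 x : 0 <= vabs x.
Proof.
have h : 0 <= vabs x + vabs x by rewrite -(subrr x) vleD ?vle_abs ?vle_absN.
have := @vscale_ge0 R E (2^-1 : R) _ _ h.
rewrite -mulr2n -scaler_nat scalerA mulVf ?scale1r ?pnatr_eq0//.
by apply; rewrite invr_ge0.
Qed.

Lemma vabs_le x y : (vabs x <= y) = (x <= y) && (- x <= y).
Proof. exact: vleUx. Qed.

Lemma vabs_id x : 0 <= x -> vabs x = x.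
Proof. by move=> x0; apply: vjoin_l; rewrite (le_trans _ x0)// voppr_le0. Qed.

Lemma vabs_eq0 x : vabs x = 0 -> x = 0.
Proof.
move=> x0; apply/eqP; rewrite eq_le -{1}x0 vle_abs/=.
by rewrite -voppr_le0 -x0 vle_absN.
Qed.

Lemma vabs0 : vabs (0 : E) = 0.
Proof. exact/vabs_id. Qed.

Lemma vabsD x y : vabs (x + y) <= vabs x + vabs y.
Proof. by rewrite vabs_le opprD !vleD ?vle_abs ?vle_absN. Qed.

Lemma vabsZ_le a x : vabs (a *: x) <= `|a| *: vabs x.
Proof.
wlog a0 : a x / 0 <= a => [hw|].
  have [/hw//|/ltW a0] := leP 0 a.
  by rewrite -[a]opprK scaleNr -scalerN -(vabsN x) normrN hw// oppr_ge0.
by rewrite ger0_norm// vabs_le -scalerN !vler_scale// ?vle_abs ?vle_absN.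
Qed.

Lemma vabs_joinB x y u v :
  vabs (vjoin x y - vjoin u v) <= vabs (x - u) + vabs (y - v).
Proof.
have h x' y' u' v' : vjoin x' y' <= vjoin u' v' +
    (vabs (x' - u') + vabs (y' - v')).
  rewrite vleUx; apply/andP; split.
    rewrite addrA vler_wpDr ?vabs_ge0// addrC -{1}[x'](subrK u').
    by rewrite vleD ?vleUl ?vle_abs.
  rewrite [vabs _ + _]addrC addrA vler_wpDr ?vabs_ge0// addrC.
  by rewrite -{1}[y'](subrK v') vleD ?vleUr ?vle_abs.
rewrite vabs_le opprB !vleBlDr [_ + vjoin u v]addrC [_ + vjoin x y]addrC h.
by rewrite -(vabsN (x - u)) -(vabsN (y - v)) !opprB h.
Qed.

Lemma vmeetDl x y z : 0 <= x -> 0 <= y -> 0 <= z ->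
  vmeet (x + y) z <= vmeet x z + vmeet y z.
Proof.
move=> x0 y0 z0; set t := vmeet _ z.
have t1 : t <= x + y by exact: vleIl.
have t2 : t <= z by exact: vleIr.
rewrite [leRHS]addrC -vleBlDr voppI addrC vjoinD2r vlexI !vleUx.
rewrite ![- _ + t]addrC !vleBlDr [y + x]addrC t1 [y + z]addrC !vler_wpDr//.
Qed.

Lemma vmeet_eq0_le x y z : 0 <= x -> x <= y -> 0 <= z ->
  vmeet y z = 0 -> vmeet x z = 0.
Proof.
move=> x0 xy z0 yz; apply/eqP; rewrite eq_le vlexI x0 z0 andbT -yz vlexI vleIr.
by rewrite (le_trans (vleIl _ _)).
Qed.

Lemma vmeet_eq0Z a x z : 0 <= a -> 0 <= x -> 0 <= z ->
  vmeet x z = 0 -> vmeet (a *: x) z = 0.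
Proof.
move=> a0 x0 z0 xz; have b0 : (0 : R) < Num.max a 1 by rewrite lt_max ltr01 orbT.
have b1 : 0 <= (Num.max a 1)^-1 by rewrite invr_ge0 ltW.
have h : vmeet (Num.max a 1 *: x) z <= 0.
  set m := vmeet _ _.
  have mx : (Num.max a 1)^-1 *: m <= vmeet x z.
    rewrite vlexI; apply/andP; split.
      have := vler_scale b1 (vleIl (Num.max a 1 *: x) z).
      by rewrite scalerA mulVf ?gt_eqF// scale1r.
    rewrite (le_trans (vler_scale b1 (vleIr _ _)))// -[leRHS]scale1r.
    by rewrite vler_scaler// invf_le1// le_max lexx orbT.
  have := vler_scale (ltW b0) mx.
  by rewrite scalerA divff ?gt_eqF// scale1r xz scaler0.
apply/eqP; rewrite eq_le vlexI z0 vscale_ge0// andbT (le_trans _ h)// vlexI.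
by rewrite vleIr (le_trans (vleIl _ _))// vler_scaler// le_max lexx.
Qed.

End VectorLatticeTheory.

Section BasicNotions.
Context {R : realType}.
Implicit Types E F : vectorLatticeType R.

Definition dedekind_complete E := forall A : set E,
  A !=set0 -> ubound A !=set0 -> supremums A !=set0.

Definition lattice_isomorphism E F (f : E -> F) :=
  [/\ linear f, bijective f,
      {morph f : u v / vmeet u v} & {morph f : u v / vjoin u v}].

Definition vector_sublattice E (S : set E) :=
  [/\ S 0,
      (forall (a : R) (u v : E), S u -> S v -> S (a *: u + v)),
      (forall u v : E, S u -> S v -> S (vmeet u v)) &
      (forall u v : E, S u -> S v -> S (vjoin u v))].

(* [A] is downward directed, hence nonempty, with infimum 0: without the first
   conjunct the empty set would qualify in the trivial space. *)
Definition decreases_to0 E (A : set E) :=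
  [/\ A !=set0,
      (forall u v, A u -> A v -> exists w, [/\ A w, w <= u & w <= v]) &
      infimums A 0].

End BasicNotions.

(* A vector sublattice [S] of [E] as a vector lattice [vsub_of S]. *)
Record vsublattice (R : realType) (E : vectorLatticeType R) := VSublattice {
  vsub_set :> set E ;
  vsub_setP : vector_sublattice vsub_set
}.

Section VSubOf.
Context {R : realType} {E : vectorLatticeType R} (S : vsublattice E).

Record vsub_of := VSubOf { vsub_val :> E ; vsub_valP : vsub_val \in vsub_set S }.

Definition vsub_mem (u : E) (Su : vsub_set S u) : vsub_of := VSubOf (mem_set Su).

HB.instance Definition _ := [isSub for vsub_val].
HB.instance Definition _ := [Choice of vsub_of by <:].

Fact vsub_submod : submod_closed (mem (vsub_set S)).
Proof.
have [S0 SD _ _] := vsub_setP S.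
split=> [|a u v /set_mem Su /set_mem Sv]; first exact/mem_set.
by apply/mem_set/SD.
Qed.
HB.instance Definition _ :=
  GRing.SubChoice_isSubLmodule.Build R E _ vsub_of vsub_submod.

HB.instance Definition _ := Order.SubChoice_isSubPOrder.Build
  ring_display E (mem (vsub_set S)) ring_display vsub_of.

Lemma vsub_valZD (a : R) (x y : vsub_of) :
  vsub_val (a *: x + y) = a *: vsub_val x + vsub_val y.
Proof. by []. Qed.

Lemma vsub_val0 : vsub_val (0 : vsub_of) = 0.
Proof. by []. Qed.

Fact vsub_meet (x y : vsub_of) : vsub_set S (vmeet (vsub_val x) y).
Proof. by have [_ _ SI _] := vsub_setP S; apply: SI; apply/set_mem/vsub_valP. Qed.
Fact vsub_join (x y : vsub_of) : vsub_set S (vjoin (vsub_val x) y).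
Proof. by have [_ _ _ SU] := vsub_setP S; apply: SU; apply/set_mem/vsub_valP. Qed.
Definition vsub_vmeet (x y : vsub_of) : vsub_of := vsub_mem (vsub_meet x y).
Definition vsub_vjoin (x y : vsub_of) : vsub_of := vsub_mem (vsub_join x y).

Lemma vsub_leE (x y : vsub_of) : (x <= y) = (vsub_val x <= vsub_val y).
Proof. by []. Qed.
Fact vsub_lexI x y z : (z <= vsub_vmeet x y) = (z <= x) && (z <= y).
Proof. by rewrite !vsub_leE vlexI. Qed.
Fact vsub_leUx x y z : (vsub_vjoin x y <= z) = (x <= z) && (y <= z).
Proof. by rewrite !vsub_leE vleUx. Qed.
Fact vsub_le_add2r (z x y : vsub_of) : x <= y -> x + z <= y + z.
Proof. by rewrite !vsub_leE => h; exact: vle_add2r. Qed.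
Fact vsub_scale_ge0 (a : R) (x : vsub_of) : 0 <= a -> 0 <= x -> 0 <= a *: x.
Proof. by move=> a0; rewrite !vsub_leE => h; exact: vscale_ge0. Qed.
HB.instance Definition _ := Lmodule_isVectorLattice.Build R vsub_of
  vsub_lexI vsub_leUx vsub_le_add2r vsub_scale_ge0.

End VSubOf.

(* Extension to [E] of an additive and homogeneous functional on the positive
   cone. *)
Section ConeExtension.
Context {R : realType} {E : vectorLatticeType R}.
Variable g : E -> R.
Hypothesis gD : forall u v : E, 0 <= u -> 0 <= v -> g (u + v) = g u + g v.
Hypothesis gZ : forall (a : R) (u : E), 0 < a -> 0 <= u -> g (a *: u) = a * g u.

Definition cone_ext (u : E) : R^o := g (vpos u) - g (vpos (- u)).

Fact cone_g0 : g 0 = 0.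
Proof. by apply: (addIr (g 0)); rewrite -gD// addr0 add0r. Qed.

Lemma cone_ext_ge0 u : 0 <= u -> cone_ext u = g u.
Proof.
by move=> u0; rewrite /cone_ext vposN !vpos_id// subrr cone_g0 subr0.
Qed.

Lemma cone_extE (u a b : E) : 0 <= a -> 0 <= b -> u = a - b ->
  cone_ext u = g a - g b.
Proof.
move=> a0 b0 uE; have h : vpos u + b = a + vpos (- u).
  by apply: (addIr (- b)); rewrite addrK addrAC -uE -{2}(vposB u) subrK.
apply: (addIr (g (vpos (- u)) + g b)); rewrite /cone_ext [LHS]addrA subrK.
by rewrite [X in _ = _ + X]addrC [RHS]addrA subrK -!gD ?vpos_ge0// h.
Qed.

Lemma cone_ext_linear : linear cone_ext.
Proof.
have extD u v : cone_ext (u + v) = cone_ext u + cone_ext v.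
  rewrite (@cone_extE _ (vpos u + vpos v) (vpos (- u) + vpos (- v)))
    ?vaddr_ge0 ?vpos_ge0//.
    by rewrite !gD ?vpos_ge0// /cone_ext opprD addrACA.
  by rewrite opprD addrACA !vposB.
have extN u : cone_ext (- u) = - cone_ext u.
  by rewrite /cone_ext opprK opprB.
have extZ a u : 0 < a -> cone_ext (a *: u) = a * cone_ext u.
  move=> a0; have au (b : E) : 0 <= a *: vpos b.
    by rewrite vscale_ge0 ?vpos_ge0 ?ltW.
  rewrite (cone_extE (au u) (au (- u))) ?gZ ?vpos_ge0// -?mulrBr//.
  by rewrite -scalerBr vposB.
move=> a u v; rewrite extD; congr (_ + _).
have [a0|a0|->] := ltgtP a 0.
- by rewrite -[a]opprK scaleNr extN extZ ?oppr_gt0// [RHS]mulNr.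
- exact: extZ.
- by rewrite scale0r scale0r cone_ext_ge0// cone_g0.
Qed.

End ConeExtension.

Definition order_bounded (R : realType) (E : vectorLatticeType R) (f : E -> R) :=
  forall a b : E, exists M : R, forall u, a <= u -> u <= b -> `|f u| <= M.

Section OrderDual.
Context {R : realType} (E : vectorLatticeType R).

Definition order_dual_pred : {pred E -> R^o} :=
  fun f => `[< linear f /\ order_bounded f >].

Record order_dual := OrderDual {
  odual_fun : E -> R^o ;
  odual_funP : odual_fun \in order_dual_pred
}.

Definition odual_app (phi : order_dual) (u : E) : R := odual_fun phi u.
Coercion odual_app : order_dual >-> Funclass.

HB.instance Definition _ := [isSub for odual_fun].
HB.instance Definition _ := [Choice of order_dual by <:].

Fact order_dual_submod : submod_closed order_dual_pred.
Proof.
split=> [|a f g /asboolP[fl fb] /asboolP[gl gb]]; apply/asboolP.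
  split=> [a u v|a b]; first by rewrite scaler0 addr0.
  by exists 0 => u _ _; rewrite normr0.
split=> [b u v|x y].
  rewrite !fctE fl gl !scalerDr !scalerA [a * b]mulrC -!addrA; congr (_ + _).
  by rewrite addrCA.
have [[M fM] [N gN]] := (fb x y, gb x y).
exists (`|a| * M + N) => u xu uy.
rewrite (le_trans (ler_normD _ _))// lerD ?gN// normrM ler_wpM2l//.
exact: fM.
Qed.
HB.instance Definition _ :=
  GRing.SubChoice_isSubLmodule.Build R (E -> R^o) _ order_dual order_dual_submod.

Implicit Types (phi psi : order_dual) (u v w : E).

Lemma odualP phi : linear (odual_fun phi) /\ order_bounded phi.
Proof. by case: phi => f fP; exact/asboolP. Qed.

Definition mk_odual (f : E -> R^o) (fl : linear f) (fb : order_bounded f) :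
  order_dual := OrderDual (asboolT (conj fl fb)).

Lemma odual_ext phi psi : phi =1 psi -> phi = psi.
Proof. by move=> h; apply/val_inj/funext. Qed.

Lemma odual_addE phi psi u : (phi + psi) u = phi u + psi u. Proof. by []. Qed.
Lemma odual_oppE phi u : (- phi) u = - phi u. Proof. by []. Qed.
Lemma odual_scaleE (a : R) phi u : (a *: phi) u = a * phi u. Proof. by []. Qed.
Lemma odual_0E u : (0 : order_dual) u = 0. Proof. by []. Qed.

Lemma odualZD phi (a : R) u v : phi (a *: u + v) = a * phi u + phi v.
Proof. by have [h _] := odualP phi; exact: h. Qed.
Lemma odual0 phi : phi 0 = 0.
Proof.
have /eqP := odualZD phi 1 0 0.
by rewrite scaler0 addr0 mul1r -subr_eq subrr => /eqP.
Qed.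
Lemma odualD phi u v : phi (u + v) = phi u + phi v.
Proof. by rewrite -[u in LHS]scale1r odualZD mul1r. Qed.
Lemma odualZ phi (a : R) u : phi (a *: u) = a * phi u.
Proof. by rewrite -[_ *: _]addr0 odualZD odual0 addr0. Qed.
Lemma odualN phi u : phi (- u) = - phi u.
Proof. by rewrite -scaleN1r odualZ mulN1r. Qed.
Lemma odualB phi u v : phi (u - v) = phi u - phi v.
Proof. by rewrite odualD odualN. Qed.

Definition odual_le phi psi := `[< forall u, 0 <= u -> phi u <= psi u >].

Fact odual_le_refl : reflexive odual_le.
Proof. by move=> phi; apply/asboolP. Qed.
Fact odual_le_anti : antisymmetric odual_le.
Proof.
move=> phi psi /andP[/asboolP h /asboolP k]; apply: odual_ext => u.
have e v : 0 <= v -> phi v = psi v by move=> v0; apply/eqP; rewrite eq_le h ?k.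
by rewrite -(vposB u) !odualB !e ?vpos_ge0.
Qed.
Fact odual_le_trans : transitive odual_le.
Proof.
move=> psi phi chi /asboolP h /asboolP k; apply/asboolP => u u0.
exact: le_trans (h u u0) (k u u0).
Qed.
HB.instance Definition _ := Order.Le_isPOrder.Build ring_display order_dual
  odual_le_refl odual_le_anti odual_le_trans.

Lemma odual_leP phi psi :
  reflect (forall u, 0 <= u -> phi u <= psi u) (phi <= psi).
Proof. exact: asboolP. Qed.

Lemma odual_ge0 phi u : 0 <= phi -> 0 <= u -> 0 <= phi u.
Proof. by move=> /odual_leP h /h; rewrite odual_0E. Qed.

Lemma odual_mono phi u v : 0 <= phi -> u <= v -> phi u <= phi v.
Proof.
by move=> /odual_leP h uv; rewrite -subr_ge0 -odualB; apply: h; rewrite vsubr_ge0.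
Qed.

Section PositivePart.
Variable phi : order_dual.

(* [sup_(0 <= v <= u) phi v], the Riesz-Kantorovich formula. *)
Definition rk_set (u : E) : set R := [set phi v | v in [set v | 0 <= v <= u]].
Definition rk_sup (u : E) : R := sup (rk_set u).

Lemma rk_ub u v : 0 <= v -> v <= u -> phi v <= rk_sup u.
Proof.
move=> v0 vu; apply: ub_le_sup; last by exists v => //=; rewrite v0 vu.
have [_ /(_ 0 u)[M hM]] := odualP phi.
exists M => _ [w /= /andP[w0 wu] <-].
by rewrite (le_trans (ler_norm _))// hM.
Qed.

Lemma rk_le u (M : R) : 0 <= u ->
  (forall v, 0 <= v -> v <= u -> phi v <= M) -> rk_sup u <= M.
Proof.
move=> u0 h; apply: ge_sup; first by exists (phi 0), 0 => //=; rewrite lexx.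
by move=> _ [v /= /andP[v0 vu] <-]; exact: h.
Qed.

Lemma rk_supD u v : 0 <= u -> 0 <= v -> rk_sup (u + v) = rk_sup u + rk_sup v.
Proof.
move=> u0 v0; apply/eqP; rewrite eq_le; apply/andP; split.
  apply: rk_le => [|w w0 wuv]; first exact: vaddr_ge0.
  rewrite -[w](subrK (vmeet w u)) addrC odualD lerD// rk_ub//.
  - by rewrite vlexI w0.
  - exact: vleIr.
  - by rewrite vsubr_ge0 vleIl.
  - by rewrite vmeetB vleUx v0 vleBlDr addrC.
rewrite -lerBrDr; apply: rk_le => // w w0 wu.
rewrite lerBrDr addrC -lerBrDr; apply: rk_le => // x x0 xv.
by rewrite lerBrDr -odualD rk_ub ?vaddr_ge0 1?addrC ?vleD.
Qed.

Lemma rk_supZ (a : R) u : 0 < a -> 0 <= u -> rk_sup (a *: u) = a * rk_sup u.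
Proof.
have h (b : R) w : 0 < b -> 0 <= w -> rk_sup (b *: w) <= b * rk_sup w.
  move=> b0 w0; have bi0 : 0 <= b^-1 by rewrite invr_ge0 ltW.
  apply: rk_le => [|v v0 vw]; first by rewrite vscale_ge0// ltW.
  rewrite -ler_pdivrMl// -odualZ rk_ub ?vscale_ge0//.
  by have := vler_scale bi0 vw; rewrite scalerA mulVf ?gt_eqF// scale1r.
move=> a0 u0; apply/eqP; rewrite eq_le h//= -ler_pdivlMl//.
rewrite -{1}[u]scale1r -(@mulVf _ a) ?gt_eqF// -scalerA h ?invr_gt0//.
by rewrite vscale_ge0// ltW.
Qed.

Definition odual_pos_fun : E -> R^o := cone_ext rk_sup.

Lemma odual_pos_linear : linear odual_pos_fun.
Proof. exact: (cone_ext_linear rk_supD rk_supZ). Qed.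

Lemma odual_pos_funE u : 0 <= u -> odual_pos_fun u = rk_sup u.
Proof. exact: (cone_ext_ge0 rk_supD). Qed.

End PositivePart.

Lemma pos_order_bounded (f : E -> R^o) : linear f ->
  (forall u, 0 <= u -> 0 <= (f u : R)) -> order_bounded f.
Proof.
move=> fl f0 a b; exists (`|f b : R| + `|f a : R|).
have fm u v : u <= v -> (f u : R) <= f v.
  rewrite -vsubr_ge0 => /f0; rewrite -[v - u]addr0 -scaleN1r addr0 addrC fl.
  by rewrite scaleN1r addrC subr_ge0.
move=> u /fm au /fm ub; rewrite ler_norml; apply/andP; split.
  rewrite lerNl (@le_trans _ _ `|f a : R|)// ?lerDr//.
  by rewrite -normrN (le_trans _ (ler_norm _))// lerN2.
by rewrite (le_trans ub)// (le_trans (ler_norm _))// lerDl.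
Qed.

Fact odual_pos_ge0 phi u : 0 <= u -> 0 <= (odual_pos_fun phi u : R).
Proof. by move=> u0; rewrite odual_pos_funE// -(odual0 phi) rk_ub. Qed.

Definition odual_pos phi : order_dual := mk_odual (odual_pos_linear phi)
  (pos_order_bounded (odual_pos_linear phi) (@odual_pos_ge0 phi)).

Definition odual_join phi psi : order_dual := odual_pos (phi - psi) + psi.
Definition odual_meet phi psi : order_dual := - odual_join (- phi) (- psi).

Lemma odual_posE phi u : 0 <= u -> odual_pos phi u = rk_sup phi u.
Proof. exact: odual_pos_funE. Qed.

Lemma odual_pos_le phi psi : (odual_pos phi <= psi) = (phi <= psi) && (0 <= psi).
Proof.
apply/idP/andP => [/odual_leP h|[/odual_leP h /odual_leP k]].
  split; apply/odual_leP => u u0; apply: le_trans (h u u0); rewrite odual_posE//.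
    exact: rk_ub.
  by rewrite odual_0E -(odual0 phi) rk_ub.
apply/odual_leP => u u0; rewrite odual_posE//; apply: rk_le => // v v0 vu.
by rewrite (le_trans (h v v0))// odual_mono//; exact/odual_leP.
Qed.

Lemma odual_leBrDr phi psi chi : (phi <= psi - chi) = (phi + chi <= psi).
Proof.
apply/odual_leP/odual_leP => h u u0; have := h u u0;
  by rewrite !odual_addE odual_oppE lerBrDr.
Qed.

Fact odual_le_add2r chi phi psi : phi <= psi -> phi + chi <= psi + chi.
Proof.
by move=> /odual_leP h; apply/odual_leP => u u0; rewrite !odual_addE lerD2r h.
Qed.

Fact odual_leN2 phi psi : (- phi <= - psi) = (psi <= phi).
Proof.
apply/odual_leP/odual_leP => h u u0; have := h u u0;
  by rewrite !odual_oppE lerN2.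
Qed.

Fact odual_leUx phi psi chi :
  (odual_join phi psi <= chi) = (phi <= chi) && (psi <= chi).
Proof.
by rewrite /odual_join -odual_leBrDr odual_pos_le !odual_leBrDr subrK add0r.
Qed.

Fact odual_lexI phi psi chi :
  (chi <= odual_meet phi psi) = (chi <= phi) && (chi <= psi).
Proof.
by rewrite /odual_meet -[chi in LHS]opprK odual_leN2 odual_leUx !odual_leN2.
Qed.

Fact odual_scale_ge0 (a : R) phi : 0 <= a -> 0 <= phi -> 0 <= a *: phi.
Proof.
move=> a0 /odual_leP h; apply/odual_leP => u u0.
by rewrite odual_scaleE mulr_ge0// h.
Qed.

HB.instance Definition _ := Lmodule_isVectorLattice.Build R order_dual
  odual_lexI odual_leUx odual_le_add2r odual_scale_ge0.

End OrderDual.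

(* A functional [f] is order continuous if [inf |f[A]| = 0] whenever [A]
   decreases to 0; the infimum is that of the set of the [|f u|], [u] in [A]. *)
Definition order_continuous (R : realType) (E : vectorLatticeType R)
    (f : E -> R) :=
  forall A : set E, decreases_to0 A -> infimums [set `|f u| | u in A] 0.

Section OrderContinuousDual.
Context {R : realType} (E : vectorLatticeType R).
Implicit Types (phi psi : order_dual E) (u v w : E) (A : set E) (f g : E -> R).

Lemma infimums0P f A : infimums [set `|f u| | u in A] 0 <->
  forall e : R, 0 < e -> exists2 u, A u & `|f u| < e.
Proof.
split=> [[_ h] e e0|h].
  apply: contrapT => he; suff /h : lbound [set `|f u| | u in A] e.
    by rewrite leNgt e0.
  move=> _ [u Au <-]; rewrite leNgt; apply/negP => fu.
  by apply: he; exists u.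
split=> [_ [u _ <-]|x xlb]; first exact: normr_ge0.
rewrite leNgt; apply/negP => /h[u Au].
by rewrite ltNge => /negP; apply; apply: xlb; exists u.
Qed.

Lemma dec0_ge0 A u : decreases_to0 A -> A u -> 0 <= u.
Proof. by move=> [_ _ [h _]] /h. Qed.

Lemma order_continuous_eventually f A (e : R) :
  order_continuous f -> decreases_to0 A -> 0 < e ->
  exists2 u0, A u0 & forall u, A u -> u <= u0 -> `|f u| < e.
Proof.
move=> fc Ad e0; apply: contrapT => h.
have cofinal u0 : A u0 -> exists u, [/\ A u, u <= u0 & e <= `|f u|].
  move=> Au0; apply: contrapT => h1; apply: h; exists u0 => // u Au uu0.
  by rewrite ltNge; apply/negP => he; apply: h1; exists u.
pose A' := [set u | A u /\ e <= `|f u|].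
have [[a0 Aa0] Adir [Alb Ainf]] := Ad.
have /fc/infimums0P/(_ _ e0)[u [_ eu]] : decreases_to0 A'.
  split.
  - by have [u [Au _ eu]] := cofinal _ Aa0; exists u.
  - move=> u v [Au _] [Av _]; have [w [Aw wu wv]] := Adir _ _ Au Av.
    have [x [Ax xw ex]] := cofinal _ Aw.
    by exists x; split => //; [exact: le_trans wu|exact: le_trans wv].
  - split=> [u [Au _]|x xlb]; first exact: Alb.
    apply: Ainf => u Au; have [w [Aw wu ew]] := cofinal _ Au.
    by rewrite (le_trans _ wu)// xlb.
by rewrite ltNge eu.
Qed.

Lemma order_continuousZD (a : R) f g : order_continuous f ->
  order_continuous g -> order_continuous (fun u => a * f u + g u).
Proof.
move=> fc gc A Ad; apply/infimums0P => e e0.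
have a1 : 0 < `|a| + 1 by rewrite ltr_wpDl.
have e1 : 0 < e / 2 / (`|a| + 1) by rewrite !divr_gt0.
have e2 : 0 < e / 2 by rewrite divr_gt0.
have [u Au fu] := order_continuous_eventually fc Ad e1.
have [v Av gv] := order_continuous_eventually gc Ad e2.
have [_ /(_ _ _ Au Av)[w [Aw wu wv]] _] := Ad.
exists w => //; rewrite (le_lt_trans (ler_normD _ _))// [ltRHS]splitr.
rewrite ler_ltD ?gv// normrM (@le_trans _ _ ((`|a| + 1) * `|f w|))//.
  by rewrite ler_wpM2r// lerDl.
by rewrite mulrC -ler_pdivlMr// ltW// fu.
Qed.

Lemma order_continuous_pos phi :
  order_continuous phi -> order_continuous (odual_pos phi).
Proof.
move=> fc A Ad; apply/infimums0P => e e0.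
have e2 : 0 < e / 2 by rewrite divr_gt0.
have [[u0 Au0] Adir [Alb Ainf]] := Ad.
have u00 := Alb _ Au0.
have [v [v0 vu0 hv]] :
    exists v, [/\ 0 <= v, v <= u0 & rk_sup phi u0 - e / 2 < phi v].
  apply: contrapT => h.
  suff : rk_sup phi u0 <= rk_sup phi u0 - e / 2.
    by rewrite lerBrDr gerDl leNgt e2.
  apply: rk_le => // v v0 vu0; rewrite leNgt; apply/negP => hv.
  by apply: h; exists v.
pose A' := [set vmeet v u | u in [set u | A u /\ u <= u0]].
have /fc/infimums0P/(_ _ e2)[_ [u [Au uu0] <-] hu] : decreases_to0 A'.
  split.
  - by exists (vmeet v u0), u0.
  - move=> _ _ [x [Ax xu0] <-] [y [Ay yu0] <-].
    have [w [Aw wx wy]] := Adir _ _ Ax Ay.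
    exists (vmeet v w); split.
    + by exists w => //; split => //; exact: le_trans xu0.
    + by rewrite vlexI vleIl (le_trans (vleIr _ _)).
    + by rewrite vlexI vleIl (le_trans (vleIr _ _)).
  - split=> [_ [x [Ax _] <-]|b bA]; first by rewrite vlexI v0 Alb.
    apply: Ainf => x Ax; have [w [Aw wx wu0]] := Adir _ _ Ax Au0.
    rewrite (le_trans _ wx)// (@le_trans _ _ (vmeet v w)) ?vleIr//.
    by apply: bA; exists w.
have u_0 := Alb _ Au.
exists u => //; rewrite odual_posE// ger0_norm; last first.
  by rewrite -(odual0 phi) rk_ub.
have := @rk_supD _ _ phi (u0 - u) u.
rewrite vsubr_ge0 subrK => /(_ uu0 u_0) rkE.
have h1 : phi v - phi (vmeet v u) <= rk_sup phi (u0 - u).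
  rewrite -odualB rk_ub// ?vsubr_ge0 ?vleIl// vmeetB vleUx vsubr_ge0 uu0.
  by rewrite vleD2rE.
have h2 := le_lt_trans (ler_norm _) hu.
rewrite [ltRHS]splitr.
have -> : rk_sup phi u = rk_sup phi u0 - rk_sup phi (u0 - u).
  by rewrite rkE addrAC subrr add0r.
rewrite ltrBlDr (lt_le_trans (y := e / 2 + phi v))//.
  by rewrite addrC -ltrBlDr.
rewrite -addrA lerD2l -lerBlDl (le_trans _ h1)//.
by rewrite lerB// ltW.
Qed.

Definition order_continuous_set : set (order_dual E) :=
  [set phi | order_continuous phi].

Fact order_continuous_vsub : vector_sublattice order_continuous_set.
Proof.
have ocZD (a : R) phi psi : order_continuous phi -> order_continuous psi ->
    order_continuous (a *: phi + psi) by exact: order_continuousZD.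
have oc0 : order_continuous (0 : order_dual E).
  move=> A [[u Au] _ _]; apply/infimums0P => e e0; exists u => //.
  by rewrite odual_0E normr0.
have ocN phi : order_continuous phi -> order_continuous (- phi).
  by move=> h; rewrite -[- phi]addr0 -scaleN1r; exact/ocZD.
have ocU phi psi : order_continuous phi -> order_continuous psi ->
    order_continuous (vjoin phi psi).
  move=> h k; rewrite /vjoin/= /odual_join -[odual_pos _]scale1r.
  apply/ocZD => //; apply: order_continuous_pos.
  by rewrite -[phi]scale1r; apply/ocZD => //; exact/ocN.
split=> // phi psi h k.
by apply/ocN/ocU; exact/ocN.
Qed.

Definition oc_dual_sub : vsublattice (order_dual E) :=
  VSublattice order_continuous_vsub.

Definition oc_dual := vsub_of oc_dual_sub.

Lemma oc_dualP (phi : oc_dual) : order_continuous (vsub_val phi).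
Proof. exact: set_mem (vsub_valP phi). Qed.

End OrderContinuousDual.

Section CanonicalMap.
Context {R : realType} (E : vectorLatticeType R).
Implicit Types (u v w : E) (A : set (oc_dual E)).
Local Notation En := (oc_dual E).

Definition ev (u : E) : En -> R^o := fun phi => vsub_val phi u.

Fact ev_linear u : linear (ev u).
Proof. by move=> a phi psi; rewrite /ev vsub_valZD odual_addE odual_scaleE. Qed.

Lemma ev_ge0 u (phi : En) : 0 <= u -> 0 <= phi -> 0 <= (ev u phi : R).
Proof. by move=> u0; rewrite vsub_leE vsub_val0 => /odual_ge0; exact. Qed.

Fact ev_posB u : ev u = (-1 : R) *: ev (vpos (- u)) + ev (vpos u).
Proof.
apply/funext => phi; rewrite fctE/= scaleN1r /ev addrC.
by rewrite -[in LHS](vposB u) odualB.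
Qed.

Fact ev_order_bounded u : order_bounded (ev u).
Proof.
have h v : 0 <= v -> order_bounded (ev v).
  move=> v0; apply: (pos_order_bounded (ev_linear v)) => phi phi0.
  exact: ev_ge0.
have [_ hZD] := order_dual_submod En.
have hin v : 0 <= v -> ev v \in @order_dual_pred R En.
  by move=> v0; apply/asboolP; split; [exact: ev_linear|exact: h].
have /asboolP[] := hZD (-1) _ _ (hin _ (vpos_ge0 (- u))) (hin _ (vpos_ge0 u)).
by rewrite -ev_posB.
Qed.

Section Infimum.
Variable A : set En.
Hypothesis Ad : decreases_to0 A.

Definition ev_inf u : R := inf [set ev u phi | phi in A].

Let A0 (phi : En) : A phi -> 0 <= vsub_val phi.
Proof. by move=> /(dec0_ge0 Ad); rewrite vsub_leE. Qed.

Fact ev_inf_lb u (phi : En) : 0 <= u -> A phi -> ev_inf u <= ev u phi.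
Proof.
move=> u0 Aphi; apply: ge_inf; last by exists phi.
by exists 0 => _ [psi /A0 psi0 <-]; exact: odual_ge0.
Qed.

Fact ev_inf_glb u (M : R) : (forall phi, A phi -> M <= ev u phi) -> M <= ev_inf u.
Proof.
move=> h; apply: lb_le_inf; last by move=> _ [phi /h ? <-].
by have [[phi Aphi] _ _] := Ad; exists (ev u phi), phi.
Qed.

Fact ev_infD u v : 0 <= u -> 0 <= v -> ev_inf (u + v) = ev_inf u + ev_inf v.
Proof.
move=> u0 v0; apply/eqP; rewrite eq_le; apply/andP; split; last first.
  apply: ev_inf_glb => phi Aphi.
  by rewrite /ev odualD lerD// ev_inf_lb.
rewrite -lerBlDr; apply: ev_inf_glb => phi Aphi.
rewrite lerBlDr -lerBlDl; apply: ev_inf_glb => psi Apsi.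
rewrite lerBlDl; have [_ /(_ _ _ Aphi Apsi)[chi [Achi le1 le2]] _] := Ad.
rewrite (le_trans (ev_inf_lb (vaddr_ge0 u0 v0) Achi))// /ev odualD.
by apply: lerD; [exact: (odual_leP _ _ le1)|exact: (odual_leP _ _ le2)].
Qed.

Fact ev_infZ (a : R) u : 0 < a -> 0 <= u -> ev_inf (a *: u) = a * ev_inf u.
Proof.
have h (b : R) w : 0 < b -> 0 <= w -> b * ev_inf w <= ev_inf (b *: w).
  move=> b0 w0; apply: ev_inf_glb => phi Aphi.
  by rewrite /ev odualZ ler_wpM2l ?ev_inf_lb// ltW.
move=> a0 u0; apply/eqP; rewrite eq_le h// andbT -ler_pdivrMl//.
rewrite -{2}[u]scale1r -(@mulVf _ a) ?gt_eqF// -scalerA h ?invr_gt0//.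
by rewrite vscale_ge0// ltW.
Qed.

Let theta_linear : linear (cone_ext ev_inf).
Proof. exact: (cone_ext_linear ev_infD ev_infZ). Qed.

Let theta_ge0 u : 0 <= u -> 0 <= (cone_ext ev_inf u : R).
Proof.
move=> u0; rewrite (cone_ext_ge0 ev_infD)//; apply: ev_inf_glb => phi /A0 phi0.
exact: odual_ge0.
Qed.

Let theta : order_dual E :=
  mk_odual theta_linear (pos_order_bounded theta_linear theta_ge0).

Let thetaE u : 0 <= u -> theta u = ev_inf u.
Proof. exact: (cone_ext_ge0 ev_infD). Qed.

Let theta_oc : order_continuous theta.
Proof.
have [[phi Aphi] _ _] := Ad.
move=> B Bd; apply/infimums0P => e e0.
have /(_ _ Bd)/infimums0P/(_ _ e0)[u Bu hu] := oc_dualP phi.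
exists u => //; have u0 := dec0_ge0 Bd Bu.
rewrite (le_lt_trans _ hu)// !ger0_norm; last 2 first.
- exact: odual_ge0 (A0 Aphi) u0.
- exact: theta_ge0.
by rewrite thetaE// ev_inf_lb.
Qed.

Fact ev_inf_le0 u : 0 <= u -> ev_inf u <= 0.
Proof.
move=> u0; have [_ _ [_ Ainf]] := Ad.
pose theta' : En := @vsub_mem _ _ (oc_dual_sub E) theta theta_oc.
have : theta' <= 0.
  apply: Ainf => phi Aphi; rewrite vsub_leE; apply/odual_leP => v v0.
  by rewrite thetaE// ev_inf_lb.
rewrite vsub_leE vsub_val0 => /odual_leP/(_ u u0).
by rewrite odual_0E thetaE.
Qed.

End Infimum.

Fact ev_order_continuous u : order_continuous (ev u).
Proof.
have h v : 0 <= v -> order_continuous (ev v).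
  move=> v0 A Ad; apply/infimums0P => e e0; apply: contrapT => he.
  suff : e <= ev_inf A v by rewrite leNgt (le_lt_trans (ev_inf_le0 Ad v0)).
  apply: (ev_inf_glb Ad) => phi Aphi; rewrite leNgt; apply/negP => hphi.
  apply: he; exists phi => //; rewrite ger0_norm//.
  exact: ev_ge0 (dec0_ge0 Ad Aphi).
by rewrite ev_posB; apply: order_continuousZD; apply: h; exact: vpos_ge0.
Qed.

Definition canonical_map (u : E) : oc_dual En :=
  @vsub_mem _ _ (oc_dual_sub En) (mk_odual (ev_linear u) (@ev_order_bounded u))
    (@ev_order_continuous u).

Lemma canonical_mapE u (phi : En) :
  vsub_val (canonical_map u) phi = vsub_val phi u.
Proof. by []. Qed.

Definition perfect := lattice_isomorphism canonical_map.

End CanonicalMap.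

Section Bands.
Context {R : realType} (E : vectorLatticeType R).
Implicit Types (u v w : E) (S : set E) (phi : order_dual E).

Definition order_ideal S :=
  [/\ S 0,
      (forall (a : R) u v, S u -> S v -> S (a *: u + v)) &
      (forall u v, S v -> vabs u <= vabs v -> S u)].

Definition band S :=
  order_ideal S /\ (forall A : set E, A `<=` S -> supremums A `<=` S).

Definition disjoint_compl S : set E :=
  [set u | forall v, S v -> vmeet (vabs u) (vabs v) = 0].

Definition projection_band S :=
  band S /\ (forall u, exists v w, [/\ S v, disjoint_compl S w & u = v + w]).

Definition null_ideal phi : set E := [set u | vabs phi (vabs u) = 0].

Definition carrier phi : set E := disjoint_compl (null_ideal phi).

Lemma order_ideal_sublattice S : order_ideal S -> vector_sublattice S.
Proof.
move=> [S0 SD Ssol].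
have SU u v : S u -> S v -> S (vjoin u v).
  move=> Su Sv; apply: (Ssol _ (1 *: vabs u + vabs v)).
    by apply: SD; [apply: (Ssol _ u)|apply: (Ssol _ v)] => //;
      rewrite vabs_id ?vabs_ge0.
  rewrite scale1r [leRHS]vabs_id ?vaddr_ge0 ?vabs_ge0//.
  by have := vabs_joinB u v 0 0; rewrite (@vjoin_l _ _ (0 : E) 0)// !subr0.
have SN u : S u -> S (- u).
  by move=> Su; rewrite -[- u]addr0 -scaleN1r; apply: SD.
split=> // u v Su Sv.
by rewrite -[vmeet _ _]opprK voppI; apply/SN/SU; apply/SN.
Qed.

Lemma disjoint_compl_ideal S : order_ideal (disjoint_compl S).
Proof.
split=> [v _|a u v uS vS x Sx|u v vS uv x Sx].
- by rewrite vabs0 vmeet_l// vabs_ge0.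
- apply: (vmeet_eq0_le _ (le_trans (vabsD _ _) (vle_add2r _ _ _ (vabsZ_le _ _))));
    rewrite ?vabs_ge0//.
  apply/eqP; rewrite eq_le vlexI vabs_ge0 vaddr_ge0 ?vscale_ge0 ?vabs_ge0//.
  rewrite !andbT (le_trans (vmeetDl _ _ _)) ?vscale_ge0 ?vabs_ge0//.
  by rewrite vS// vmeet_eq0Z ?vabs_ge0 ?uS// addr0.
- exact: (vmeet_eq0_le (vabs_ge0 _) uv (vabs_ge0 _) (vS _ Sx)).
Qed.

Lemma disjoint_compl_band S : band (disjoint_compl S).
Proof.
have [S0 SD Ssol] := disjoint_compl_ideal S.
split; first exact: disjoint_compl_ideal.
move=> A AS s [sub slub].
have [[a Aa]|A0] := pselect (A !=set0); last first.
  suff -> : s = 0 by [].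
  have sx x : s <= x by apply: slub => y Ay; exfalso; apply: A0; exists y.
  by apply/eqP; rewrite eq_le sx -(vleD2rE s 0) add0r sx.
have as0 : 0 <= s - a by rewrite vsubr_ge0 sub.
suff sa : disjoint_compl S (s - a).
  by rewrite -[s](subrK a) -[s - a]scale1r; apply: SD => //; exact: AS.
move=> v Sv; rewrite (vabs_id as0); set t := vmeet _ _.
have t0 : 0 <= t by rewrite vlexI as0 vabs_ge0.
suff : s <= s - t by rewrite vleBrDr -[leRHS]addr0 vleD2lE => t1; apply/le_anti/andP.
apply: slub => x Ax; pose p := vpos (x - a).
have pS : disjoint_compl S p.
  have [_ _ _ SU] := order_ideal_sublattice (disjoint_compl_ideal S).
  apply: SU => //; rewrite addrC -scaleN1r.
  by apply: SD; exact: AS.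
have ps : p <= s - a by rewrite vleUx as0 vleD2rE sub.
have pt : vmeet p t = 0.
  rewrite vmeetC; apply: (vmeet_eq0_le t0 (vleIr _ _)); rewrite ?vpos_ge0//.
  by rewrite vmeetC -(vabs_id (vpos_ge0 (x - a)) : vabs p = p) pS.
have h : p + t <= s - a.
  have := vmeetB p t; rewrite pt subr0 => ->.
  by rewrite vjoinD2r add0r subrK vleUx vleIl ps.
rewrite vleBrDr -[x](subrK a) addrAC -vleBrDr (le_trans _ h)//.
by rewrite vleD2rE vle_pos.
Qed.

Lemma dedekind_projection_band S :
  dedekind_complete E -> band S -> projection_band S.
Proof.
move=> hE [Sid Scl]; split => //.
have [S0 SD Ssol] := Sid.
have SDD u v : S u -> S v -> S (u + v).
  by move=> ? ?; rewrite -[u]scale1r; exact: SD.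
have SN u : S u -> S (- u).
  by move=> ?; rewrite -[- u]addr0 -scaleN1r; exact: SD.
have decomp u : 0 <= u -> exists v w, [/\ S v, disjoint_compl S w & u = v + w].
  move=> u0; pose A := [set w | [/\ S w, 0 <= w & w <= u]].
  have A0 : A 0 by [].
  have [s As] : supremums A !=set0.
    by apply: hE; [exists 0|exists u => w []].
  have [sub slub] := As.
  have s0 : 0 <= s := sub _ A0.
  have su : s <= u by apply: slub => w [].
  have Ss : S s by apply: (Scl A) => // w [].
  exists s, (u - s); split => //; last by rewrite addrC subrK.
  move=> b Sb; rewrite vabs_id ?vsubr_ge0//; set t := vmeet _ _.
  have t0 : 0 <= t by rewrite vlexI vsubr_ge0 su vabs_ge0.
  have St : S t by apply: (Ssol _ b) => //; rewrite vabs_id// vleIr.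
  have : A (s + t).
    by split; [exact: SDD|exact: vaddr_ge0|rewrite addrC -vleBrDr vleIl].
  move=> /sub; rewrite -[leRHS]addr0 vleD2lE => t1.
  by apply/le_anti/andP.
move=> u.
have [v [w [Sv Sw uE]]] := decomp _ (vpos_ge0 u).
have [v' [w' [Sv' Sw' uE']]] := decomp _ (vpos_ge0 (- u)).
exists (v - v'), (w - w'); split.
- by apply/SDD/SN.
- have [_ dD _] := disjoint_compl_ideal S.
  by rewrite addrC -scaleN1r; exact: dD.
- by rewrite addrACA -opprD -uE -uE' vposB.
Qed.

End Bands.

(* The elements of the Boolean algebra of projection bands of [E]; its order is
   the inclusion of the underlying sets. *)
Record pband (R : realType) (E : vectorLatticeType R) := PBand {
  pband_set : set E ;
  pbandP : projection_band pband_set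
}.

Section ProjectionBands.
Context {R : realType} {E : vectorLatticeType R}.
Implicit Types (u v w : E) (A B : pband E) (M : set (pband E)).

Definition pband_vsub B : vsublattice E :=
  VSublattice (order_ideal_sublattice (pbandP B).1.1).

Fact pband_proj_subproof B u :
  exists v, pband_set B v /\ disjoint_compl (pband_set B) (u - v).
Proof.
have [_ /(_ u)[v [w [Bv Bw ->]]]] := pbandP B.
by exists v; split => //; rewrite addrAC subrr add0r.
Qed.

(* The band projection [P_B], as a map from [E] to [E] with values in [B]. *)
Definition pband_proj B u : E := projT1 (cid (pband_proj_subproof B u)).

Lemma pband_projP B u :
  pband_set B (pband_proj B u) /\
  disjoint_compl (pband_set B) (u - pband_proj B u).
Proof. by rewrite /pband_proj; case: cid. Qed.

Lemma pband_proj_uniq B u v : pband_set B v ->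
  disjoint_compl (pband_set B) (u - v) -> pband_proj B u = v.
Proof.
move=> Bv uv; have [Bp up] := pband_projP B u.
have [[_ BD _] _] := (pbandP B).1.
have [_ dD _] := disjoint_compl_ideal (pband_set B).
apply/eqP; rewrite -subr_eq0; apply/eqP/vabs_eq0.
have h1 : pband_set B (pband_proj B u - v).
  by rewrite addrC -scaleN1r; exact: BD.
have h2 : disjoint_compl (pband_set B) (pband_proj B u - v).
  have := dD (-1) _ _ up uv.
  by rewrite scaleN1r opprB addrA subrK.
by have := h2 _ h1; rewrite vmeet_l.
Qed.

Lemma pband_proj_linear B : linear (pband_proj B).
Proof.
move=> a u v; have [[_ BD _] _] := (pbandP B).1.
have [_ dD _] := disjoint_compl_ideal (pband_set B).
have [[Bu du] [Bv dv]] := (pband_projP B u, pband_projP B v).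
apply: pband_proj_uniq; first exact: BD.
by rewrite opprD addrACA -scalerBr; exact: dD.
Qed.

Lemma pband_proj_join B : {morph pband_proj B : u v / vjoin u v}.
Proof.
move=> u v; have [_ _ _ BU] := order_ideal_sublattice (pbandP B).1.1.
have [_ dD dsol] := disjoint_compl_ideal (pband_set B).
have [[Bu du] [Bv dv]] := (pband_projP B u, pband_projP B v).
apply: pband_proj_uniq; first exact: BU.
apply: (dsol _ (1 *: vabs (u - pband_proj B u) + vabs (v - pband_proj B v))).
  by apply: dD; [apply: (dsol _ (u - pband_proj B u))|
    apply: (dsol _ (v - pband_proj B v))] => //; rewrite vabs_id ?vabs_ge0.
by rewrite scale1r [leRHS]vabs_id ?vaddr_ge0 ?vabs_ge0// vabs_joinB.
Qed.

Lemma pband_proj0 B : pband_proj B 0 = 0.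
Proof.
have [[B0 _ _] _] := (pbandP B).1.
have [d0 _ _] := disjoint_compl_ideal (pband_set B).
by apply: pband_proj_uniq => //; rewrite subr0.
Qed.

Lemma pband_projN B u : pband_proj B (- u) = - pband_proj B u.
Proof.
by have := pband_proj_linear B (-1) u 0; rewrite pband_proj0 !addr0 !scaleN1r.
Qed.

Lemma pband_proj_meet B : {morph pband_proj B : u v / vmeet u v}.
Proof.
move=> u v; apply: oppr_inj.
by rewrite -pband_projN !voppI pband_proj_join !pband_projN.
Qed.

Lemma pband_proj_sub A B u : pband_set A `<=` pband_set B ->
  pband_proj A (pband_proj B u) = pband_proj A u.
Proof.
move=> AB; have [[Au du] [Bu dBu]] := (pband_projP A u, pband_projP B u).
apply: pband_proj_uniq => //.
have [_ dD _] := disjoint_compl_ideal (pband_set A).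
have dA : disjoint_compl (pband_set A) (u - pband_proj B u).
  by move=> x /AB; exact: dBu.
have := dD (-1) _ _ dA du.
by rewrite scaleN1r opprB addrA subrK.
Qed.

End ProjectionBands.

(* Families of elements of [E] indexed by [I], with the coordinatewise
   operations. *)
Definition vfamily (R : realType) (I : Type) (E : vectorLatticeType R) := I -> E.

Section Families.
Context {R : realType} (I : Type) (E : vectorLatticeType R).
Local Notation T := (vfamily I E).
Implicit Types x y z : T.

HB.instance Definition _ := GRing.Lmodule.copy T (I -> E).

Definition vfamily_le x y := `[< forall i, x i <= y i >].

Fact vfamily_le_refl : reflexive vfamily_le.
Proof. by move=> x; apply/asboolP. Qed.
Fact vfamily_le_anti : antisymmetric vfamily_le.
Proof.
move=> x y /andP[/asboolP xy /asboolP yx]; apply/funext => i.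
by apply/le_anti; rewrite xy yx.
Qed.
Fact vfamily_le_trans : transitive vfamily_le.
Proof.
move=> y x z /asboolP xy /asboolP yz; apply/asboolP => i.
exact: le_trans (xy i) (yz i).
Qed.
HB.instance Definition _ := Order.Le_isPOrder.Build ring_display T
  vfamily_le_refl vfamily_le_anti vfamily_le_trans.

Lemma vfamily_leP x y : reflect (forall i, x i <= y i) (x <= y).
Proof. exact: asboolP. Qed.

Definition vfamily_meet x y : T := fun i => vmeet (x i) (y i).
Definition vfamily_join x y : T := fun i => vjoin (x i) (y i).

Fact vfamily_lexI x y z : (z <= vfamily_meet x y) = (z <= x) && (z <= y).
Proof.
apply/vfamily_leP/andP => [h|[/vfamily_leP h /vfamily_leP k] i].
  by split; apply/vfamily_leP => i; have := h i; rewrite vlexI => /andP[].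
by rewrite vlexI h k.
Qed.
Fact vfamily_leUx x y z : (vfamily_join x y <= z) = (x <= z) && (y <= z).
Proof.
apply/vfamily_leP/andP => [h|[/vfamily_leP h /vfamily_leP k] i].
  by split; apply/vfamily_leP => i; have := h i; rewrite vleUx => /andP[].
by rewrite vleUx h k.
Qed.
Fact vfamily_le_add2r z x y : x <= y -> x + z <= y + z.
Proof. by move=> /vfamily_leP h; apply/vfamily_leP => i; exact: vle_add2r. Qed.
Fact vfamily_scale_ge0 (a : R) x : 0 <= a -> 0 <= x -> 0 <= a *: x.
Proof.
move=> a0 /vfamily_leP h; apply/vfamily_leP => i.
exact: (@vscale_ge0 R E a (x i) a0 (h i)).
Qed.
HB.instance Definition _ := Lmodule_isVectorLattice.Build R T
  vfamily_lexI vfamily_leUx vfamily_le_add2r vfamily_scale_ge0.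

End Families.

Section InverseLimit.
Context {R : realType} {E : vectorLatticeType R} (M : set (pband E)).
Implicit Types (A B : set_type M) (x : vfamily (set_type M) E).

(* The compatible families [(u_B)], [u_B] in [B], as a subset of the power
   [E ^ M]. *)
Definition invlim_set : set (vfamily (set_type M) E) := [set x |
  (forall B, pband_set (val B) (x B)) /\
  (forall A B, pband_set (val A) `<=` pband_set (val B) ->
     pband_proj (val A) (x B) = x A)].

Fact invlim_sublattice : vector_sublattice invlim_set.
Proof.
split.
- by split=> [B|A B _]; [have [[B0 _ _] _] := (pbandP (val B)).1|exact: (pband_proj0 (val A))].
- move=> a x y [xB xP] [yB yP]; split=> [B|A B AB].
    by have [[_ BD _] _] := (pbandP (val B)).1; exact: (BD a (x B) (y B)).
  by rewrite [LHS](pband_proj_linear _ a (x B) (y B)) xP// yP.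
- move=> x y [xB xP] [yB yP]; split=> [B|A B AB].
    by have [_ _ BI _] := vsub_setP (pband_vsub (val B)); exact: (BI (x B) (y B) (xB B) (yB B)).
  by rewrite [LHS](pband_proj_meet _ (x B) (y B)) xP// yP.
- move=> x y [xB xP] [yB yP]; split=> [B|A B AB].
    by have [_ _ _ BU] := vsub_setP (pband_vsub (val B)); exact: (BU (x B) (y B) (xB B) (yB B)).
  by rewrite [LHS](pband_proj_join _ (x B) (y B)) xP// yP.
Qed.

Definition invlim_sub : vsublattice (vfamily (set_type M) E) :=
  VSublattice invlim_sublattice.

Definition invlim := vsub_of invlim_sub.

Fact proj_family_invlim (u : E) : invlim_set (fun B => pband_proj (val B) u).
Proof.
by split=> [B|A B]; [exact: (pband_projP _ _).1|exact: pband_proj_sub].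
Qed.

Definition proj_invlim (u : E) : invlim :=
  @vsub_mem _ _ invlim_sub _ (proj_family_invlim u).

End InverseLimit.

Section PerfectCarriers.
Context {R : realType} (E : vectorLatticeType R).

(* Directed sets are nonempty, here as in [decreases_to0]. *)
Definition pband_ideal (M : set (pband E)) :=
  [/\ M !=set0,
      (forall A B, M B -> pband_set A `<=` pband_set B -> M A) &
      (forall A B, M A -> M B -> exists C,
         [/\ M C, pband_set A `<=` pband_set C & pband_set B `<=` pband_set C])].

(* If [E] is Dedekind complete then every carrier is a projection band, by
   [carrier_projection_band]. *)
Definition perfect_carriers : set (pband E) := [set B |
  exists phi : oc_dual E, [/\ 0 <= phi, pband_set B = carrier (vsub_val phi) &
    perfect (vsub_of (pband_vsub B))]].

Lemma carrier_projection_band (phi : order_dual E) :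
  dedekind_complete E -> projection_band (carrier phi).
Proof. by move=> hE; exact/dedekind_projection_band/disjoint_compl_band. Qed.

End PerfectCarriers.

Arguments perfect_carriers {R} E _.

(* Main.v *)
(* Write B for a projection band and P_B for its projection. A space is perfect
   as soon as its order continuous functionals detect positivity and every
   order continuous functional Phi on them is an evaluation. This criterion
   passes to retracts by order continuous positive maps (hence to bands) and to
   sums of two bands, which gives (i): C_(phi + psi) is generated by C_phi and
   C_psi, and a band A inside C_phi is the carrier of phi o P_A.
   For (ii), if E is perfect, then a compatible family (u_B) is the image of the
   u representing phi |-> phi(u_(C_|phi|)). Conversely, for B in M_p the
   functional psi |-> Phi(psi o P_B) is evaluation at some u_B in B; the u_B are
   compatible, so they come from some u in E, and Phi is evaluation at u because
   phi - phi o P_B decreases to 0 along M_p for every positive phi. *)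
Require Import Defs.
From HB Require Import structures.
From mathcomp Require Import all_boot all_order all_algebra.
From mathcomp Require Import all_classical all_reals.
From mathcomp Require Import lra.

Set Implicit Arguments.
Unset Strict Implicit.
Unset Printing Implicit Defensive.

Import Order.TTheory GRing.Theory Num.Theory.

Local Open Scope classical_set_scope.
Local Open Scope ring_scope.

Lemma inj_surj_bijective (T U : Type) (f : T -> U) :
  injective f -> (forall y, exists x, f x = y) -> bijective f.
Proof. by move=> finj /choice[g gK]; exists g => // x; apply: finj. Qed.

(** * Pointwise calculus of order continuous functionals *)

Section OrderContinuousFunctionals.
Context {R : realType} {E : vectorLatticeType R}.
Implicit Types (u v w : E) (phi psi chi : oc_dual E).

Lemma oc_leP phi psi : reflect
  (forall u, 0 <= u -> vsub_val phi u <= vsub_val psi u) (phi <= psi).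
Proof. rewrite vsub_leE; exact: odual_leP. Qed.

Lemma oc_ge0 phi u : 0 <= phi -> 0 <= u -> 0 <= vsub_val phi u.
Proof. by move=> /oc_leP h /h; rewrite vsub_val0. Qed.

Lemma oc_ext phi psi : (forall u, vsub_val phi u = vsub_val psi u) -> phi = psi.
Proof. by move=> h; apply/val_inj/odual_ext. Qed.

Lemma oc_ZDE (a : R) phi psi u :
  vsub_val (a *: phi + psi) u = a * vsub_val phi u + vsub_val psi u.
Proof. by rewrite vsub_valZD odual_addE odual_scaleE. Qed.

Lemma oc_addE phi psi u :
  vsub_val (phi + psi) u = vsub_val phi u + vsub_val psi u.
Proof. by rewrite -[phi in LHS]scale1r oc_ZDE mul1r. Qed.

Lemma oc_subE phi psi u :
  vsub_val (phi - psi) u = vsub_val phi u - vsub_val psi u.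
Proof. by rewrite addrC -scaleN1r oc_ZDE mulN1r addrC. Qed.

Lemma oc_0E u : vsub_val (0 : oc_dual E) u = 0.
Proof. by rewrite vsub_val0. Qed.

Lemma oc_oppE phi u : vsub_val (- phi) u = - vsub_val phi u.
Proof. by rewrite -[- phi]add0r oc_subE oc_0E sub0r. Qed.

Lemma vabsB_ge0 u : 0 <= vabs u - u.
Proof. by rewrite vsubr_ge0 vle_abs. Qed.

Lemma vabsD_ge0 u : 0 <= vabs u + u.
Proof. by rewrite -[u in X in _ + X]opprK vsubr_ge0 vle_absN. Qed.

(** Adding [phi <= vabs phi] at |u| + u to [- phi <= vabs phi] at |u| - u gives twice the claim. *)
Lemma oc_le_abs phi u : vsub_val phi u <= vsub_val (vabs phi) (vabs u).
Proof.
have /oc_leP/(_ _ (vabsD_ge0 u)) := vle_abs phi.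
have /oc_leP/(_ _ (vabsB_ge0 u)) := vle_absN phi.
rewrite oc_oppE !odualD !odualN.
move: (vsub_val phi u) (vsub_val phi (vabs u)) (vsub_val (vabs phi) u)
  (vsub_val (vabs phi) (vabs u)) => a b c d.
by lra.
Qed.

Lemma oc_norm_le phi u : `|vsub_val phi u| <= vsub_val (vabs phi) (vabs u).
Proof.
by rewrite ler_norml lerNl -odualN -{1}(vabsN u) !oc_le_abs.
Qed.
End OrderContinuousFunctionals.

(** * Decrease to 0 in the order continuous dual, tested pointwise *)

Section DualDecrease.
Context {R : realType} {E : vectorLatticeType R}.
Implicit Types (u v w : E) (phi psi : oc_dual E) (D : set (oc_dual E)).

Lemma dec0_oc_small D v (e : R) : decreases_to0 D -> 0 <= v -> 0 < e ->
  exists2 phi, D phi & vsub_val phi v < e.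
Proof.
move=> Dd v0 e0; have /infimums0P/(_ _ e0)[phi Dphi h] := ev_order_continuous v Dd.
by exists phi => //; apply: le_lt_trans h; exact: ler_norm.
Qed.

(** A lower bound [chi] with [chi v > 0] for some positive [v] would contradict smallness at [v] for
    the threshold [chi v]. *)
Lemma oc_dec0 D : D !=set0 ->
  (forall phi psi, D phi -> D psi ->
    exists chi, [/\ D chi, chi <= phi & chi <= psi]) ->
  (forall phi, D phi -> 0 <= phi) ->
  (forall v (e : R), 0 <= v -> 0 < e -> exists2 phi, D phi & vsub_val phi v < e) ->
  decreases_to0 D.
Proof.
move=> D0 Ddir Dge Dsmall; split => //; split; first exact: Dge.
move=> chi chile; apply/oc_leP => v v0; rewrite oc_0E leNgt; apply/negP => h.
have [phi Dphi] := Dsmall v _ v0 h.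
by rewrite ltNge; have /oc_leP/(_ v v0) -> := chile _ Dphi.
Qed.

End DualDecrease.

(** * Order continuous positive operators and their adjoints *)

(** Order continuity is stated as preservation of decrease to 0, which composes and turns order
    continuous functionals on [G] into such functionals on [F]. *)
Record normal_op (R : realType) (F G : vectorLatticeType R) := NormalOp {
  nop :> F -> G ;
  nop_linear : linear nop ;
  nop_ge0 : forall u, 0 <= u -> 0 <= nop u ;
  nop_dec0 : forall A, decreases_to0 A -> decreases_to0 (nop @` A) }.

Section NormalOperators.
Context {R : realType}.
Implicit Types F G H : vectorLatticeType R.

Lemma nop_sub F G (f : normal_op F G) u v : f (u - v) = f u - f v.
Proof. by rewrite addrC -scaleN1r nop_linear scaleN1r addrC. Qed.

Lemma nop_mono F G (f : normal_op F G) u v : u <= v -> f u <= f v.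
Proof. by rewrite -vsubr_ge0 => /(nop_ge0 f); rewrite nop_sub vsubr_ge0. Qed.

Definition nop_comp F G H (g : normal_op G H) (f : normal_op F G) :
  normal_op F H.
Proof.
apply: (@NormalOp _ _ _ (g \o f)).
- by move=> a u v /=; rewrite !nop_linear.
- by move=> u u0; exact/nop_ge0/nop_ge0.
- by move=> A Ad; rewrite -image_comp; exact/nop_dec0/nop_dec0.
Defined.

Lemma nop_compE F G H (g : normal_op G H) (f : normal_op F G) u :
  nop_comp g f u = g (f u).
Proof. by []. Qed.

Section Pullback.
Variables (F G : vectorLatticeType R) (f : normal_op F G).
Implicit Types phi : oc_dual G.

Definition pull_fun phi : F -> R^o := fun u => vsub_val phi (f u).

Fact pull_linear phi : linear (pull_fun phi).
Proof. by move=> a u v; rewrite /pull_fun nop_linear odualZD. Qed.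

Fact pull_bounded phi : order_bounded (pull_fun phi).
Proof.
move=> a b; have [_ /(_ (f a) (f b))[M hM]] := odualP (vsub_val phi).
by exists M => u au ub; apply: hM; exact: nop_mono.
Qed.

Fact pull_order_continuous phi :
  order_continuous_set (mk_odual (pull_linear phi) (@pull_bounded phi)).
Proof.
move=> A Ad; apply/infimums0P => e e0.
have := oc_dualP phi (nop_dec0 f Ad).
by move=> /infimums0P/(_ _ e0)[_ [u Au <-] h]; exists u.
Qed.

(** This is the adjoint of [f] between the order continuous duals. *)
Definition pull phi : oc_dual F :=
  @vsub_mem _ _ (oc_dual_sub F) _ (@pull_order_continuous phi).

Lemma pullE phi u : vsub_val (pull phi) u = vsub_val phi (f u).
Proof. by []. Qed.

Fact pull_is_linear : linear pull.
Proof. by move=> a phi psi; apply: oc_ext => u; rewrite oc_ZDE !pullE oc_ZDE. Qed.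

Fact pull_ge0 phi : 0 <= phi -> 0 <= pull phi.
Proof.
move=> phi0; apply/oc_leP => u u0.
by rewrite oc_0E pullE; apply: oc_ge0 => //; exact: nop_ge0.
Qed.

Fact pull_dec0 A : decreases_to0 A -> decreases_to0 (pull @` A).
Proof.
move=> Ad; have [[phi0 Aphi0] Adir _] := Ad; apply: oc_dec0.
- by exists (pull phi0), phi0.
- move=> _ _ [phi Aphi <-] [psi Apsi <-].
  have [w [Aw w1 w2]] := Adir _ _ Aphi Apsi; exists (pull w); split.
  + by exists w.
  + apply/oc_leP => u u0; rewrite !pullE; apply/oc_leP => //; exact: nop_ge0.
  + apply/oc_leP => u u0; rewrite !pullE; apply/oc_leP => //; exact: nop_ge0.
- by move=> _ [phi /(dec0_ge0 Ad) phi0' <-]; exact: pull_ge0.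
- move=> v e v0 e0; have [phi Aphi h] := dec0_oc_small Ad (nop_ge0 f v0) e0.
  by exists (pull phi); first by exists phi.
Qed.

(** The adjoint is again a normal operator, so it has an adjoint in turn, which acts on the
    biduals. *)
Definition pull_op : normal_op (oc_dual G) (oc_dual F) :=
  NormalOp pull_is_linear pull_ge0 pull_dec0.

End Pullback.

End NormalOperators.

(** * A criterion for perfectness, and its permanence properties *)

Section PerfectCriterion.
Context {R : realType}.
Implicit Types E F G : vectorLatticeType R.

Definition oc_reflects E :=
  forall u : E, (forall phi : oc_dual E, 0 <= phi -> 0 <= vsub_val phi u) -> 0 <= u.

Definition oc_reflexive E := forall Phi : oc_dual (oc_dual E),
  exists u : E, forall phi, vsub_val Phi phi = vsub_val phi u.

Lemma canonical_linear E : linear (@canonical_map R E).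
Proof.
move=> a u v; apply: oc_ext => phi.
by rewrite oc_ZDE !canonical_mapE odualZD.
Qed.

Lemma oc_separates E (u v : E) : oc_reflects E ->
  (forall phi : oc_dual E, vsub_val phi u = vsub_val phi v) -> u = v.
Proof.
move=> Er h; apply/eqP; rewrite eq_le -(vsubr_ge0 u) -(vsubr_ge0 v).
by apply/andP; split; apply: Er => phi _; rewrite odualB h subrr.
Qed.

(* An order-reflecting monotone surjection preserves meets and joins. *)
Lemma perfectP E : perfect E <-> oc_reflects E /\ oc_reflexive E.
Proof.
split=> [[lin bij cI cU]|[Er Es]].
  split=> [u hu|Phi]; last first.
    have [g gK Kg] := bij; exists (g Phi) => phi.
    by rewrite -(canonical_mapE (g Phi)) Kg.
  have h : 0 <= canonical_map u.
    by apply/oc_leP => phi phi0; rewrite oc_0E canonical_mapE hu.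
  have c0 : canonical_map (0 : E) = 0.
    by apply: oc_ext => phi; rewrite canonical_mapE odual0 oc_0E.
  (* Positivity is encoded as an equation between meets, which an injective lattice map reflects. *)
  have e : vmeet 0 u = 0 by apply: (bij_inj bij); rewrite cI c0 vmeet_l.
  by rewrite -e vleIr.
have le_can (u v : E) : (canonical_map u <= canonical_map v) = (u <= v).
  apply/idP/idP => [/oc_leP h|uv].
    rewrite -vsubr_ge0; apply: Er => phi phi0; rewrite odualB subr_ge0.
    by have := h phi phi0; rewrite !canonical_mapE.
  apply/oc_leP => phi phi0; rewrite !canonical_mapE -subr_ge0 -odualB.
  by apply: oc_ge0 => //; rewrite vsubr_ge0.
have surj Phi : exists u : E, canonical_map u = Phi.
  have [u hu] := Es Phi; exists u; apply: oc_ext => phi.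
  by rewrite canonical_mapE hu.
split; first exact: canonical_linear.
- apply: inj_surj_bijective => // u v uv.
  by apply: oc_separates => // phi; rewrite -(canonical_mapE u) uv canonical_mapE.
- move=> u v; apply/eqP; rewrite eq_le vlexI !le_can vleIl vleIr /=.
  have [w wE] := surj (vmeet (canonical_map u) (canonical_map v)).
  by rewrite -wE le_can vlexI -!le_can wE vleIl vleIr.
- move=> u v; apply/eqP; rewrite eq_le vleUx !le_can vleUl vleUr andbT.
  have [w wE] := surj (vjoin (canonical_map u) (canonical_map v)).
  by rewrite -wE le_can vleUx -!le_can wE vleUl vleUr.
Qed.

(** Positivity of [x] is tested on [i x] in [F]. A functional [Phi] on the dual of [X] is carried to
    the dual of [F] by [pull i]; if [u] represents the result then [p u] represents [Phi], because
    [pull i] undoes [pull p]. *)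
Lemma perfect_retract F X (i : normal_op X F) (p : normal_op F X) :
  (forall x, p (i x) = x) -> perfect F -> perfect X.
Proof.
move=> pi /perfectP[Fr Fs]; apply/perfectP; split=> [x hx|Phi].
  rewrite -(pi x); apply/nop_ge0/Fr => phi phi0.
  by rewrite -pullE; apply: hx; exact: pull_ge0.
have [u hu] := Fs (pull (pull_op i) Phi).
exists (p u) => psi; rewrite -pullE -hu pullE.
by congr (vsub_val Phi _); apply: oc_ext => x; rewrite !pullE pi.
Qed.

(** The second hypothesis is inclusion-exclusion for the projections [i p] and [j q]. Dualizing it
    splits [Phi] into three terms, each represented through [X] or [Y]. *)
Lemma perfect_sum F X Y (i : normal_op X F) (p : normal_op F X)
    (j : normal_op Y F) (q : normal_op F Y) :
  (forall u, 0 <= p u -> 0 <= q u -> 0 <= u) ->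
  (forall u, u = i (p u) + j (q u) - i (p (j (q u)))) ->
  perfect X -> perfect Y -> perfect F.
Proof.
move=> pq0 idE /perfectP[Xr Xs] /perfectP[Yr Ys]; apply/perfectP; split.
  move=> u hu; apply: pq0; [apply: Xr|apply: Yr] => psi psi0; rewrite -pullE;
    by apply: hu; exact: pull_ge0.
move=> Phi; have [x hx] := Xs (pull (pull_op p) Phi).
have [y hy] := Ys (pull (pull_op q) Phi).
exists (i x + j y - i (p (j y))) => phi.
have hi : vsub_val phi (i x) = vsub_val Phi (pull p (pull i phi)).
  by have := hx (pull i phi); rewrite !pullE => ->.
have hj (chi : oc_dual F) : vsub_val chi (j y) = vsub_val Phi (pull q (pull j chi)).
  by have := hy (pull j chi); rewrite !pullE => ->.
(* The overlap term: the representation through [Y] is applied to the functional phi o i o p. *)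
have hij := hj (pull p (pull i phi)); rewrite !pullE in hij.
rewrite odualB odualD hi hj hij.
rewrite -odualD -odualB; congr (vsub_val Phi _); apply: oc_ext => u.
by rewrite oc_subE oc_addE !pullE {1}[u]idE odualB odualD.
Qed.

End PerfectCriterion.

Lemma vsub_valB (R : realType) (E : vectorLatticeType R) (S : vsublattice E)
  (x y : vsub_of S) : vsub_val (x - y) = vsub_val x - vsub_val y.
Proof. by rewrite addrC -scaleN1r vsub_valZD scaleN1r addrC. Qed.

Lemma vsub_valD (R : realType) (E : vectorLatticeType R) (S : vsublattice E)
  (x y : vsub_of S) : vsub_val (x + y) = vsub_val x + vsub_val y.
Proof. by rewrite -[x]scale1r vsub_valZD !scale1r. Qed.

Lemma vsub_ext (R : realType) (E : vectorLatticeType R) (S : vsublattice E)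
  (x y : vsub_of S) : vsub_val x = vsub_val y -> x = y.
Proof. exact: val_inj. Qed.

(** * Band projections as normal operators, and perfectness of bands *)

Section BandProjections.
Context {R : realType} {E : vectorLatticeType R}.
Implicit Types (u v w : E) (A B : pband E).

Lemma pband_proj_in A u : pband_set A (pband_proj A u).
Proof. exact: (pband_projP A u).1. Qed.

Lemma pband_proj_id A u : pband_set A u -> pband_proj A u = u.
Proof.
move=> Au; apply: pband_proj_uniq => //; rewrite subrr.
by have [] := disjoint_compl_ideal (pband_set A).
Qed.

Lemma pband_proj_eq0 A u : disjoint_compl (pband_set A) u -> pband_proj A u = 0.
Proof.
move=> Au; apply: pband_proj_uniq; last by rewrite subr0.
by have [[]] := (pbandP A).1.
Qed.

Lemma pband_projB A u v : pband_proj A (u - v) = pband_proj A u - pband_proj A v.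
Proof. by rewrite addrC -scaleN1r pband_proj_linear scaleN1r addrC. Qed.

Lemma pband_proj_ge0 A u : 0 <= u -> 0 <= pband_proj A u.
Proof.
by move=> u0; rewrite -(vpos_id u0) /vpos pband_proj_join pband_proj0 vleUr.
Qed.

Lemma ideal_compl_disjoint (S : set E) u : S u -> disjoint_compl S u -> u = 0.
Proof.
move=> Su /(_ u Su); rewrite vmeet_l// => h; exact: vabs_eq0.
Qed.

Lemma pband_solid A u v : pband_set A v -> 0 <= u -> u <= v -> pband_set A u.
Proof.
move=> Av u0 uv; have [[_ _ As] _] := (pbandP A).1.
by apply: As Av _; rewrite !vabs_id// (le_trans u0 uv).
Qed.

(** The negative part of u - P_A u lies below P_A u, hence in [A], and is also disjoint from [A]; so
    it is 0. *)
Lemma pband_proj_le A u : 0 <= u -> pband_proj A u <= u.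
Proof.
move=> u0; rewrite -vsubr_ge0; set y := u - _.
have y0 : vpos (- y) = 0.
  apply: (@ideal_compl_disjoint (pband_set A)).
    apply: (pband_solid (pband_proj_in A u)); first exact: vpos_ge0.
    rewrite vleUx pband_proj_ge0// andbT opprB vleBlDr.
    by rewrite vler_wpDr.
  have [_ _ ds] := disjoint_compl_ideal (pband_set A).
  apply: ds (pband_projP A u).2 _; rewrite (vabs_id (vpos_ge0 _)).
  by rewrite vleUx vle_absN vabs_ge0.
by rewrite -[y]vposB y0 subr0 vpos_ge0.
Qed.

Lemma pband_proj_mono A u v : u <= v -> pband_proj A u <= pband_proj A v.
Proof.
by rewrite -vsubr_ge0 => /(pband_proj_ge0 A); rewrite pband_projB vsubr_ge0.
Qed.

Lemma pband_projC_mono A u v :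
  u <= v -> u - pband_proj A u <= v - pband_proj A v.
Proof.
rewrite -vsubr_ge0 => /(pband_proj_le A).
by rewrite pband_projB !vleBrDr addrAC [_ + u]addrC addrAC.
Qed.

Lemma pband_projC_abs A u : vabs (u - pband_proj A u) <= vabs u.
Proof.
have h v : v <= vabs u -> v - pband_proj A v <= vabs u.
  move=> /(pband_projC_mono A) vu; apply: le_trans vu _.
  by rewrite vleBlDr vler_wpDr// pband_proj_ge0 ?vabs_ge0.
rewrite vabs_le h ?vle_abs//= opprB.
by have := h (- u) (vle_absN u); rewrite pband_projN opprK addrC.
Qed.

Section Operators.
Variable A : pband E.
Local Notation VA := (vsub_of (pband_vsub A)).

Fact pband_incl_dec0 (D : set VA) :
  decreases_to0 D -> decreases_to0 ((fun x : VA => vsub_val x) @` D).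
Proof.
move=> [[x0 Dx0] Ddir [Dlb Dglb]]; split.
- by exists (vsub_val x0), x0.
- move=> _ _ [x Dx <-] [y Dy <-]; have [z [Dz zx zy]] := Ddir _ _ Dx Dy.
  by exists (vsub_val z); split; [exists z|rewrite -vsub_leE|rewrite -vsub_leE].
- split=> [_ [x Dx <-]|w wlb]; first by have := Dlb _ Dx; rewrite vsub_leE.
  (* A lower bound [w] in the whole space need not lie in [A], but its positive part does: it is
     below an element of [D]. *)
  rewrite (le_trans (vle_pos w))//.
  have wle x : D x -> vpos w <= vsub_val x.
    move=> Dx; rewrite vleUx; apply/andP; split; first by apply: wlb; exists x.
    by have := Dlb _ Dx; rewrite vsub_leE.
  have Aw : pband_set A (vpos w).
    by apply: (pband_solid _ (vpos_ge0 w) (wle _ Dx0)); exact/set_mem/vsub_valP.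
  have := Dglb (@vsub_mem _ _ (pband_vsub A) _ Aw).
  by rewrite vsub_leE; apply=> x Dx; rewrite vsub_leE wle.
Qed.

Definition pband_incl : normal_op VA E.
Proof.
apply: (@NormalOp R VA E (fun x : VA => vsub_val x)).
- by move=> a u v; exact: vsub_valZD.
- by move=> u; rewrite vsub_leE.
- exact: pband_incl_dec0.
Defined.

Definition pband_restr_fun u : VA :=
  @vsub_mem _ _ (pband_vsub A) _ (pband_proj_in A u).

Lemma pband_restr_funE u : vsub_val (pband_restr_fun u) = pband_proj A u.
Proof. by []. Qed.

Fact pband_restr_linear : linear pband_restr_fun.
Proof.
move=> a u v; apply: vsub_ext.
by rewrite vsub_valZD !pband_restr_funE pband_proj_linear.
Qed.

Fact pband_restr_ge0 u : 0 <= u -> 0 <= pband_restr_fun u.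
Proof.
by move=> u0; rewrite vsub_leE vsub_val0 pband_restr_funE pband_proj_ge0.
Qed.

(** Since P_A x <= x for positive x, a lower bound of the projected set is also one of [D]. *)
Fact pband_restr_dec0 (D : set E) :
  decreases_to0 D -> decreases_to0 (pband_restr_fun @` D).
Proof.
move=> Dd; have [[x0 Dx0] Ddir [Dlb Dglb]] := Dd; split.
- by exists (pband_restr_fun x0), x0.
- move=> _ _ [x Dx <-] [y Dy <-]; have [z [Dz zx zy]] := Ddir _ _ Dx Dy.
  exists (pband_restr_fun z); split; first by exists z.
    by rewrite vsub_leE !pband_restr_funE pband_proj_mono.
  by rewrite vsub_leE !pband_restr_funE pband_proj_mono.
- split=> [_ [x Dx <-]|w wlb]; first exact/pband_restr_ge0/Dlb.
  rewrite vsub_leE vsub_val0; apply: Dglb => x Dx.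
  have := wlb (pband_restr_fun x); rewrite vsub_leE pband_restr_funE => h.
  apply: (le_trans (h _)); first by exists x.
  by apply: pband_proj_le; exact: Dlb.
Qed.

Definition pband_restr : normal_op E VA :=
  NormalOp pband_restr_linear pband_restr_ge0 pband_restr_dec0.

Lemma pband_restrE u : vsub_val (pband_restr u) = pband_proj A u.
Proof. by []. Qed.

Lemma pband_inclE (x : VA) : pband_incl x = vsub_val x.
Proof. by []. Qed.

Lemma pband_valP (x : VA) : pband_set A (vsub_val x).
Proof. exact: (set_mem (vsub_valP x)). Qed.

Lemma pband_restr_incl (x : VA) : pband_restr (vsub_val x) = x.
Proof.
by apply: vsub_ext; rewrite pband_restrE pband_proj_id//; exact: pband_valP.
Qed.

End Operators.

Lemma perfect_pband A : perfect E -> perfect (vsub_of (pband_vsub A)).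
Proof.
apply: (@perfect_retract _ _ _ (pband_incl A) (pband_restr A)).
exact: pband_restr_incl.
Qed.

Lemma perfect_subband A B : pband_set A `<=` pband_set B ->
  perfect (vsub_of (pband_vsub B)) -> perfect (vsub_of (pband_vsub A)).
Proof.
move=> AB; apply: (@perfect_retract _ _ _
  (nop_comp (pband_restr B) (pband_incl A)) (nop_comp (pband_restr A) (pband_incl B))).
move=> x; rewrite !nop_compE !pband_inclE pband_restrE pband_proj_id.
  exact: pband_restr_incl.
exact/AB/pband_valP.
Qed.

(** The third hypothesis says that [A] and [B] generate [C]. It makes (1 - P_A)(1 - P_B) vanish on
    [C], which is the identity that [perfect_sum] asks for. *)
Lemma perfect_joinband A B C :
  pband_set A `<=` pband_set C -> pband_set B `<=` pband_set C ->
  (forall u, pband_set C u -> disjoint_compl (pband_set A) u ->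
     disjoint_compl (pband_set B) u -> u = 0) ->
  perfect (vsub_of (pband_vsub A)) -> perfect (vsub_of (pband_vsub B)) ->
  perfect (vsub_of (pband_vsub C)).
Proof.
move=> AC BC ABC.
have [[_ _ Cs] _] := (pbandP C).1.
apply: (@perfect_sum _ _ _ _
  (nop_comp (pband_restr C) (pband_incl A)) (nop_comp (pband_restr A) (pband_incl C))
  (nop_comp (pband_restr C) (pband_incl B)) (nop_comp (pband_restr B) (pband_incl C))).
- move=> u; rewrite !nop_compE !pband_inclE ![0 <= pband_restr _ _]vsub_leE.
  rewrite !vsub_val0 !pband_restrE => uA uB; rewrite vsub_leE vsub_val0.
  (* P_D commutes with joins, so it kills the negative part of a vector whose projection is
     positive. *)
  have h (D : pband E) : 0 <= pband_proj D (vsub_val u) ->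
      disjoint_compl (pband_set D) (vpos (- vsub_val u)).
    move=> uD; have [_] := pband_projP D (vpos (- vsub_val u)).
    rewrite {2}/vpos pband_proj_join pband_proj0 pband_projN vjoinC vjoin_l ?subr0//.
    by rewrite voppr_le0.
  have u0 : vpos (- vsub_val u) = 0.
    apply: ABC; [|exact: h|exact: h].
    apply: Cs (pband_valP u) _; rewrite (vabs_id (vpos_ge0 _)).
    by rewrite vleUx vle_absN vabs_ge0.
  by rewrite -[vsub_val u]vposB u0 subr0 vpos_ge0.
- move=> u; rewrite !nop_compE !pband_inclE; apply: vsub_ext.
  rewrite vsub_valB vsub_valD !pband_restrE; set x := vsub_val u.
  have projC (D : pband E) v : pband_set D `<=` pband_set C ->
      pband_proj C (pband_proj D v) = pband_proj D v.
    by move=> DC; apply/pband_proj_id/DC/pband_proj_in.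
  rewrite !projC//; set y := x - pband_proj B x.
  have Cy : pband_set C y.
    by apply: Cs (pband_valP u) _; exact: pband_projC_abs.
  have : y - pband_proj A y = 0.
    apply: ABC; first by apply: Cs Cy _; exact: pband_projC_abs.
      exact: (pband_projP A y).2.
    have [_ _ ds] := disjoint_compl_ideal (pband_set B).
    by apply: ds (pband_projP B x).2 _; exact: pband_projC_abs.
  move/eqP; rewrite subr_eq0 /y subr_eq => /eqP {1}->.
  by rewrite pband_projB addrAC.
Qed.

End BandProjections.

(** * Carriers, and the ideal of perfect carriers *)

Section Carriers.
Context {R : realType} {E : vectorLatticeType R}.
Hypothesis hE : dedekind_complete E.
Implicit Types (u v w : E) (A B : pband E) (phi psi chi : oc_dual E).

Lemma null_ideal_abs phi u : 0 <= phi ->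
  null_ideal (vsub_val phi) u <-> vsub_val phi (vabs u) = 0.
Proof.
by rewrite vsub_leE vsub_val0 => phi0; rewrite /null_ideal /mkset (vabs_id phi0).
Qed.

Lemma null_ideal_solid phi u v : 0 <= phi ->
  null_ideal (vsub_val phi) v -> vabs u <= vabs v -> null_ideal (vsub_val phi) u.
Proof.
move=> phi0 /(null_ideal_abs _ phi0) Nv uv; apply/null_ideal_abs => //.
apply/eqP; rewrite eq_le oc_ge0 ?vabs_ge0// andbT -Nv -subr_ge0 -odualB.
by rewrite oc_ge0// vsubr_ge0.
Qed.

Lemma null_ideal_mono phi psi : 0 <= phi -> phi <= psi ->
  null_ideal (vsub_val psi) `<=` null_ideal (vsub_val phi).
Proof.
move=> phi0 le_pp u /(null_ideal_abs _ (le_trans phi0 le_pp)) Nu.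
apply/null_ideal_abs => //; apply/eqP; rewrite eq_le oc_ge0 ?vabs_ge0// andbT.
by rewrite -Nu; apply/oc_leP => //; exact: vabs_ge0.
Qed.

Lemma carrier_mono phi psi : 0 <= phi -> phi <= psi ->
  carrier (vsub_val phi) `<=` carrier (vsub_val psi).
Proof. by move=> phi0 h u uC v /(null_ideal_mono phi0 h) /uC. Qed.

(* The null ideal of an order continuous functional is a band; hence it contains
   the disjoint complement of its own disjoint complement. *)
Lemma carrier_compl phi u : 0 <= phi ->
  disjoint_compl (carrier (vsub_val phi)) u -> vsub_val phi (vabs u) = 0.
Proof.
move=> phi0 uC; set a := vabs u.
have a0 : 0 <= a := vabs_ge0 u.
have N0 v : 0 <= v -> null_ideal (vsub_val phi) v <-> vsub_val phi v = 0.
  by move=> v0; rewrite (null_ideal_abs _ phi0) vabs_id.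
(* The supremum [s] of the null elements below [a] is null by order continuity. Maximality then puts
   [a - s] in the carrier; being below [a], it is also disjoint from the carrier, hence 0. *)
pose D := [set v | [/\ 0 <= v, v <= a & vsub_val phi v = 0]].
have D0 : D 0 by split => //; exact: odual0.
have [s [sub slub]] : supremums D !=set0.
  by apply: hE; [exists 0|exists a => v []].
have s0 : 0 <= s := sub _ D0.
have sa : s <= a by apply: slub => v [].
have Dd : decreases_to0 [set s - v | v in D].
  split.
  - by exists (s - 0), 0.
  - move=> _ _ [v [v0 va Nv] <-] [w [w0 wa Nw] <-].
    exists (s - vjoin v w); split.
    + exists (vjoin v w) => //; split.
      * exact: le_trans v0 (vleUl _ _).
      * by rewrite vleUx va.
      * apply/eqP; rewrite eq_le oc_ge0 ?(le_trans v0 (vleUl _ _))// andbT.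
        have -> : 0 = vsub_val phi (v + w) by rewrite odualD Nv Nw addr0.
        rewrite -subr_ge0 -odualB oc_ge0// vsubr_ge0 vleUx.
        by rewrite vler_wpDr//= addrC vler_wpDr.
    + by rewrite vleD2lE vleN2 vleUl.
    + by rewrite vleD2lE vleN2 vleUr.
  - split=> [_ [v Dv <-]|x xlb]; first by rewrite vsubr_ge0 sub.
    suff : s <= s - x by rewrite vleBrDr -[leRHS]addr0 vleD2lE.
    apply: slub => v Dv; rewrite vleBrDr addrC -vleBrDr.
    by apply: xlb; exists v.
have Ns : vsub_val phi s = 0.
  apply/eqP; rewrite eq_le oc_ge0// andbT; apply/ler_addgt0Pl => e e0.
  have /infimums0P/(_ _ e0)[_ [v [_ _ Nv] <-]] := oc_dualP phi Dd.
  rewrite odualB Nv subr0 addr0 => h; exact: le_trans (ler_norm _) (ltW h).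
suff <- : s = a by [].
apply/eqP; rewrite eq_sym -subr_eq0; apply/eqP.
have as0 : 0 <= a - s by rewrite vsubr_ge0.
have Cas : carrier (vsub_val phi) (a - s).
  move=> n Nn; rewrite vabs_id//; set t := vmeet _ _.
  have t0 : 0 <= t by rewrite vlexI as0 vabs_ge0.
  have Nt : vsub_val phi t = 0.
    apply/N0 => //; apply: null_ideal_solid Nn _ => //.
    by rewrite (vabs_id t0) vleIr.
  have : D (s + t).
    split; first exact: vaddr_ge0.
      by rewrite addrC -vleBrDr vleIl.
    by rewrite odualD Ns Nt addr0.
  move=> /sub; rewrite -[leRHS]addr0 vleD2lE => t1.
  by apply/le_anti/andP.
have := uC _ Cas; rewrite vmeetC vmeet_l ?(vabs_id as0)//.
by rewrite vleBlDr vler_wpDr.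
Qed.

(** The remainder u - P_B u is disjoint from the carrier of |phi|, so |phi| vanishes at its absolute
    value. *)
Lemma carrier_proj phi B u : carrier (vsub_val (vabs phi)) `<=` pband_set B ->
  vsub_val phi (pband_proj B u) = vsub_val phi u.
Proof.
move=> CB; apply/eqP; rewrite eq_sym -subr_eq0 -odualB -normr_le0.
rewrite (le_trans (oc_norm_le _ _))// carrier_compl ?vabs_ge0// => v /CB.
exact: (pband_projP B u).2.
Qed.

Lemma carrier_perfect phi : 0 <= phi -> perfect E ->
  exists2 B, perfect_carriers E B & pband_set B = carrier (vsub_val phi).
Proof.
move=> phi0 Ep; exists (PBand (carrier_projection_band (vsub_val phi) hE)) => //.
by exists phi; split => //; exact: perfect_pband.
Qed.

(** The carrier of the zero functional is the zero band, which is trivially perfect. *)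
Lemma perfect_carriers_nonempty : perfect_carriers E !=set0.
Proof.
pose B := PBand (carrier_projection_band (vsub_val (0 : oc_dual E)) hE).
have B0 (u : vsub_of (pband_vsub B)) : u = 0.
  apply: vsub_ext; rewrite vsub_val0; apply: (ideal_compl_disjoint _ (pband_valP u)).
  by apply/(null_ideal_abs _ (lexx 0)); rewrite oc_0E.
exists B, 0; split => //; apply/perfectP; split=> [u _|Phi]; first by rewrite [u]B0.
exists 0 => phi; have -> : phi = 0 by apply: oc_ext => u; rewrite [u]B0 odual0 oc_0E.
by rewrite odual0 oc_0E.
Qed.

Definition restr_to A : oc_dual E -> oc_dual E :=
  pull (nop_comp (pband_incl A) (pband_restr A)).

Lemma restr_toE A phi u :
  vsub_val (restr_to A phi) u = vsub_val phi (pband_proj A u).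
Proof. by rewrite pullE nop_compE pband_inclE pband_restrE. Qed.

Lemma restr_to_ge0 A phi : 0 <= phi -> 0 <= restr_to A phi.
Proof. exact: pull_ge0. Qed.

(** For [u] in the carrier, v = u - P_A u is null for phi o P_A, hence disjoint from [u]; as |v| <=
    |u|, it is 0. *)
Lemma carrier_restr_to_sub A phi : 0 <= phi ->
  carrier (vsub_val (restr_to A phi)) `<=` pband_set A.
Proof.
move=> phi0 u uC; have psi0 := restr_to_ge0 A phi0; set v := u - pband_proj A u.
have Av : disjoint_compl (pband_set A) v := (pband_projP A u).2.
have Nv : null_ideal (vsub_val (restr_to A phi)) v.
  apply/null_ideal_abs => //; rewrite restr_toE pband_proj_eq0 ?odual0//.
  have [_ _ ds] := disjoint_compl_ideal (pband_set A).
  by apply: ds Av _; rewrite vabs_id ?vabs_ge0.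
have v0 : v = 0.
  have := uC v Nv; rewrite vmeetC vmeet_l => [/vabs_eq0//|].
  exact: pband_projC_abs.
by move/eqP: v0; rewrite subr_eq0 => /eqP ->; exact: pband_proj_in.
Qed.

Lemma vabs_restr_to A phi : vabs (restr_to A phi) <= restr_to A (vabs phi).
Proof.
rewrite vabs_le; apply/andP; split; apply/oc_leP => u u0;
  rewrite ?oc_oppE !restr_toE -?oc_oppE; apply/oc_leP.
- exact: vle_abs.
- exact: pband_proj_ge0.
- exact: vle_absN.
- exact: pband_proj_ge0.
Qed.

Lemma carrier_restr_to A phi : 0 <= phi ->
  pband_set A `<=` carrier (vsub_val phi) ->
  carrier (vsub_val (restr_to A phi)) = pband_set A.
Proof.
move=> phi0 AC; have psi0 := restr_to_ge0 A phi0.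
apply/seteqP; split=> u; first exact: carrier_restr_to_sub.
move=> Au v /(null_ideal_abs _ psi0); rewrite restr_toE => Nv.
(* Since [w] lies in [A], phi(w) = phi(P_A w) <= phi(P_A |v|) = 0, so [w] is both null for [phi] and
   in its carrier. *)
set w := vmeet _ _; have w0 : 0 <= w by rewrite vlexI !vabs_ge0.
have Aw : pband_set A w.
  have [[_ _ As] _] := (pbandP A).1.
  by apply: As Au _; rewrite vabs_id// vleIl.
apply: (@ideal_compl_disjoint _ _ (null_ideal (vsub_val phi))); last exact: AC.
apply/null_ideal_abs => //; rewrite vabs_id//.
apply/eqP; rewrite eq_le oc_ge0// andbT -Nv -subr_ge0 -odualB oc_ge0//.
by rewrite -(pband_proj_id Aw) vsubr_ge0 pband_proj_mono// vleIr.
Qed.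

Lemma perfect_carriers_ideal : pband_ideal (perfect_carriers E).
Proof.
split; first exact: perfect_carriers_nonempty.
  move=> A B [phi [phi0 BC Bp]] AB.
  have AC := AB; rewrite BC in AC.
  exists (restr_to A phi); split; first exact: restr_to_ge0.
    by rewrite carrier_restr_to.
  exact: perfect_subband AB Bp.
move=> A B [phi [phi0 AE Ap]] [psi [psi0 BE Bp]].
pose C := PBand (carrier_projection_band (vsub_val (phi + psi)) hE).
have AC : pband_set A `<=` pband_set C.
  by rewrite AE; apply: carrier_mono => //; rewrite vler_wpDr.
have BC : pband_set B `<=` pband_set C.
  by rewrite BE; apply: carrier_mono => //; rewrite addrC vler_wpDr.
exists C; split => //; exists (phi + psi); split => //; first exact: vaddr_ge0.
(* A vector disjoint from both carriers is null for [phi] and for [psi], hence for their sum, whose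
   carrier is [C]. *)
apply: (perfect_joinband AC BC) => // u uC uA uB.
apply: (ideal_compl_disjoint _ uC); apply/null_ideal_abs; first exact: vaddr_ge0.
by rewrite oc_addE !carrier_compl -?AE -?BE ?addr0.
Qed.

End Carriers.

(** * The map into the inverse limit, and what its being an isomorphism provides *)

Section InverseLimitMap.
Context {R : realType} {E : vectorLatticeType R} (M : set (pband E)).
Implicit Types (u v w : E) (x y : invlim M).

Lemma invlim_ext x y : (forall B, vsub_val x B = vsub_val y B) -> x = y.
Proof. by move=> h; apply/vsub_ext/funext. Qed.

Lemma proj_invlimE u (B : set_type M) :
  vsub_val (proj_invlim M u) B = pband_proj (val B) u.
Proof. by []. Qed.

Lemma invlim_compat x (A B : set_type M) :
  pband_set (val A) `<=` pband_set (val B) ->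
  pband_proj (val A) (vsub_val x B) = vsub_val x A.
Proof. exact: (set_mem (vsub_valP x)).2. Qed.

Lemma proj_invlim_isomorphism : (forall u v : E,
    (forall B, M B -> pband_proj B u = pband_proj B v) -> u = v) ->
  (forall x, exists u, forall B : set_type M,
    pband_proj (val B) u = vsub_val x B) ->
  lattice_isomorphism (proj_invlim M).
Proof.
move=> hinj hsurj; split.
- move=> a u v; apply: invlim_ext => B; rewrite vsub_valZD.
  by rewrite proj_invlimE pband_proj_linear.
- apply: inj_surj_bijective => [u v uv|x]; last first.
    by have [u hu] := hsurj x; exists u; apply: invlim_ext => B; rewrite -hu.
  apply: hinj => B MB; rewrite -(proj_invlimE u (SigSub (mem_set MB))) uv.
  by rewrite proj_invlimE.
- by move=> u v; apply: invlim_ext => B; rewrite proj_invlimE pband_proj_meet.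
- by move=> u v; apply: invlim_ext => B; rewrite proj_invlimE pband_proj_join.
Qed.

Hypothesis iso : lattice_isomorphism (proj_invlim M).

Lemma invlim_inj u v :
  (forall B, M B -> pband_proj B u = pband_proj B v) -> u = v.
Proof.
move=> uv; have [_ bij _ _] := iso; apply: (bij_inj bij); apply: invlim_ext => B.
by rewrite !proj_invlimE uv//; exact: set_mem (valP B).
Qed.

Lemma invlim_reflects u : (forall B, M B -> 0 <= pband_proj B u) -> 0 <= u.
Proof.
move=> h; have e : vmeet 0 u = 0.
  apply: invlim_inj => B MB; rewrite pband_proj_meet pband_proj0.
  by rewrite vmeet_l// h.
by rewrite -e vleIr.
Qed.

(** The family is indexed by all bands and constrained only on [M], which keeps the subtype
    [set_type M] out of later arguments. *)
Lemma invlim_glue (f : pband E -> E) : (forall B, M B -> pband_set B (f B)) ->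
  (forall A B, M A -> M B -> pband_set A `<=` pband_set B ->
    pband_proj A (f B) = f A) ->
  exists u, forall B, M B -> pband_proj B u = f B.
Proof.
move=> fB fAB; have [_ [g _ gK] _ _] := iso.
have fM : invlim_set (M := M) (fun B => f (val B)).
  by split=> [B|A B AB]; [apply: fB|apply: fAB] => //; exact: set_mem (valP _).
exists (g (@vsub_mem _ _ (invlim_sub M) _ fM)) => B MB.
by rewrite -(proj_invlimE _ (SigSub (mem_set MB))) gK.
Qed.

End InverseLimitMap.

Section Reflexivity.
Context {R : realType} {E : vectorLatticeType R}.
Hypothesis hE : dedekind_complete E.
Local Notation Mp := (perfect_carriers E).
Implicit Types (u v w : E) (A B : pband E) (phi psi chi : oc_dual E).

(** * From perfectness to the isomorphism: gluing a compatible family *)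

Section PerfectToIso.
Hypothesis Ep : perfect E.

Variable x : invlim Mp.

Lemma carrier_index phi : exists B : set_type Mp,
  pband_set (val B) = carrier (vsub_val (vabs phi)).
Proof.
have [B MB BE] := carrier_perfect hE (vabs_ge0 phi) Ep.
by exists (SigSub (mem_set MB)).
Qed.

Definition carrier_of phi : set_type Mp := projT1 (cid (carrier_index phi)).

Lemma carrier_ofE phi :
  pband_set (val (carrier_of phi)) = carrier (vsub_val (vabs phi)).
Proof. by rewrite /carrier_of; case: cid. Qed.

Definition glued_fun phi : R^o := vsub_val phi (vsub_val x (carrier_of phi)).

(** Any larger index gives the same value: by compatibility the two components differ by a
    projection that [phi] does not see. *)
Lemma glued_funE phi (B : set_type Mp) :
  carrier (vsub_val (vabs phi)) `<=` pband_set (val B) ->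
  glued_fun phi = vsub_val phi (vsub_val x B).
Proof.
move=> CB; rewrite /glued_fun -(@invlim_compat _ _ _ _ _ B) ?carrier_ofE//.
by apply: carrier_proj; rewrite // carrier_ofE.
Qed.

(** On functionals dominated by [chi], [glued_fun] is evaluation at a single vector; this reduces
    linearity, boundedness and order continuity to those of evaluations. *)
Lemma glued_fun_le phi chi : vabs phi <= chi ->
  glued_fun phi = vsub_val phi (vsub_val x (carrier_of chi)).
Proof.
move=> le; have chi0 := le_trans (vabs_ge0 phi) le.
apply: glued_funE; rewrite carrier_ofE (vabs_id chi0).
by apply: carrier_mono => //; exact: vabs_ge0.
Qed.

Fact glued_linear : linear glued_fun.
Proof.
move=> a phi psi; pose chi := vabs (a *: phi + psi) + (vabs phi + vabs psi).
have h12 := @vaddr_ge0 _ _ _ _ (vabs_ge0 phi) (vabs_ge0 psi).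
have h3 := vabs_ge0 (a *: phi + psi).
have c3 : vabs (a *: phi + psi) <= chi by rewrite vler_wpDr.
have c1 : vabs phi <= chi.
  by rewrite /chi addrC vler_wpDr// vler_wpDr// vabs_ge0.
have c2 : vabs psi <= chi.
  by rewrite /chi addrC vler_wpDr// addrC vler_wpDr// vabs_ge0.
by rewrite (glued_fun_le c1) (glued_fun_le c2) (glued_fun_le c3) oc_ZDE.
Qed.

Fact glued_bounded : order_bounded glued_fun.
Proof.
move=> a b; set chi := vabs a + vabs b.
have [m hm] := @ev_order_bounded _ _ (vsub_val x (carrier_of chi)) a b.
exists m => phi aphi phib; rewrite (@glued_fun_le _ chi) ?hm// vabs_le.
apply/andP; split.
  by rewrite (le_trans phib)// /chi addrC vler_wpDr ?vabs_ge0// vle_abs.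
rewrite (@le_trans _ _ (- a))// ?vleN2//.
by rewrite vler_wpDr ?vabs_ge0// vle_absN.
Qed.

Fact glued_order_continuous :
  order_continuous_set (mk_odual glued_linear glued_bounded).
Proof.
move=> D Dd; apply/infimums0P => e e0; have [[phi0 Dphi0] Ddir _] := Dd.
(* Below [phi0] the glued functional is one fixed evaluation; the eventual form of order continuity
   allows passing to a member of [D] below both [phi0] and [psi]. *)
have [psi Dpsi h] := order_continuous_eventually
  (@ev_order_continuous _ _ (vsub_val x (carrier_of phi0))) Dd e0.
have [phi [Dphi phi_phi0 phi_psi]] := Ddir _ _ Dphi0 Dpsi.
exists phi => //; have := h phi Dphi phi_psi.
by rewrite /odual_app /= (@glued_fun_le _ phi0)// vabs_id// (dec0_ge0 Dd).
Qed.

Definition glued : oc_dual (oc_dual E) :=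
  @vsub_mem _ _ (oc_dual_sub (oc_dual E)) _ glued_order_continuous.

Lemma gluedE phi : vsub_val glued phi = glued_fun phi. Proof. by []. Qed.

(** Let [u] represent [glued]. The carrier of |phi o P_B| lies in [B], so phi(P_B u) is the value of
    phi o P_B at the component x_B, that is phi(x_B). *)
Lemma proj_invlim_surj : exists u, forall B : set_type Mp,
  pband_proj (val B) u = vsub_val x B.
Proof.
have [Er Es] := (perfectP E).1 Ep; have [u hu] := Es glued.
exists u => B; apply: oc_separates Er _ => phi.
rewrite -restr_toE -hu gluedE (@glued_funE _ B).
  by rewrite restr_toE pband_proj_id//; exact: (set_mem (vsub_valP x)).1.
move=> v /(carrier_mono (vabs_ge0 _) (vabs_restr_to _ _)).
exact/carrier_restr_to_sub/vabs_ge0.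
Qed.

End PerfectToIso.

(** For injectivity, each [phi] sees only the projection onto the carrier of |phi|, which is a
    perfect carrier. *)
Lemma perfect_proj_invlim : perfect E -> lattice_isomorphism (proj_invlim Mp).
Proof.
move=> Ep; apply: proj_invlim_isomorphism => [u v uv|x]; last exact: proj_invlim_surj.
have [Er _] := (perfectP E).1 Ep; apply: oc_separates Er _ => phi.
have [B MB BE] := carrier_perfect hE (vabs_ge0 phi) Ep.
by rewrite -(@carrier_proj _ _ hE _ B u) ?BE// uv// carrier_proj ?BE.
Qed.

(** * From the isomorphism to perfectness *)

Section IsoToPerfect.
Hypothesis iso : lattice_isomorphism (proj_invlim Mp).

(** Positivity may be tested on each P_B u, and there by functionals on the perfect band [B], which
    pull back to [E]. *)
Lemma proj_invlim_reflects : oc_reflects E.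
Proof.
move=> u hu; apply: (invlim_reflects iso) => B [_ [_ _ /perfectP[Br _]]].
have : 0 <= pband_restr B u.
  apply: Br => psi psi0; rewrite -pullE; apply: hu; exact: pull_ge0.
by rewrite vsub_leE vsub_val0 pband_restrE.
Qed.

Lemma restr_to_dec0 phi : 0 <= phi ->
  decreases_to0 [set phi - restr_to B phi | B in Mp].
Proof.
move=> phi0; have [[B0 MB0] _ Mdir] := perfect_carriers_ideal hE.
have projS (A B : pband E) v : pband_set A `<=` pband_set B -> 0 <= v ->
    pband_proj A v <= pband_proj B v.
  move=> AB v0; rewrite -(pband_proj_sub _ AB).
  by apply: pband_proj_le; exact: pband_proj_ge0.
apply: oc_dec0.
- by exists (phi - restr_to B0 phi), B0.
- move=> _ _ [A MA <-] [B MB <-]; have [C [MC AC BC]] := Mdir _ _ MA MB.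
  exists (phi - restr_to C phi); split; first by exists C.
    rewrite vleD2lE vleN2; apply/oc_leP => u u0; rewrite !restr_toE.
    by rewrite -subr_ge0 -odualB oc_ge0// vsubr_ge0 projS.
  rewrite vleD2lE vleN2; apply/oc_leP => u u0; rewrite !restr_toE.
  by rewrite -subr_ge0 -odualB oc_ge0// vsubr_ge0 projS.
- move=> _ [B MB <-]; rewrite vsubr_ge0; apply/oc_leP => u u0.
  by rewrite restr_toE -subr_ge0 -odualB oc_ge0// vsubr_ge0 pband_proj_le.
- move=> v e v0 e0.
  have Dd : decreases_to0 [set v - pband_proj B v | B in Mp].
    split.
    + by exists (v - pband_proj B0 v), B0.
    + move=> _ _ [A MA <-] [B MB <-]; have [C [MC AC BC]] := Mdir _ _ MA MB.
      exists (v - pband_proj C v); split; first by exists C.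
        by rewrite vleD2lE vleN2 projS.
      by rewrite vleD2lE vleN2 projS.
    + split=> [_ [B MB <-]|w wlb]; first by rewrite vsubr_ge0 pband_proj_le.
      suff -> : w = - vpos (- w) by rewrite voppr_le0 vpos_ge0.
      (* The positive part of [w] lies below v - P_B v, so its projection onto each [B] is 0;
         injectivity then makes it 0. *)
      suff w0 : vpos w = 0 by rewrite -{1}[w]vposB w0 sub0r.
      apply: (invlim_inj iso) => B MB; rewrite pband_proj0.
      apply/eqP; rewrite eq_le pband_proj_ge0 ?vpos_ge0// andbT.
      have /(pband_proj_mono B) : vpos w <= v - pband_proj B v.
        by rewrite vleUx vsubr_ge0 pband_proj_le// andbT; apply: wlb; exists B.
      move=> /le_trans; apply; rewrite pband_projB.
      by rewrite (pband_proj_id (pband_proj_in B v)) subrr.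
  have /infimums0P/(_ _ e0)[_ [B MB <-] h] := oc_dualP phi Dd.
  exists (phi - restr_to B phi); first by exists B.
  by rewrite oc_subE restr_toE -odualB; exact: le_lt_trans (ler_norm _) h.
Qed.

Lemma proj_invlim_reflexive : oc_reflexive E.
Proof.
move=> Phi.
pose represents B v := pband_set B v /\
  forall psi : oc_dual (vsub_of (pband_vsub B)),
    vsub_val Phi (pull (pband_restr B) psi) = vsub_val psi (pband_restr B v).
(* Outside the perfect carriers the choice function takes the default value 0. *)
have /choice[f fP] : forall B, exists v, Mp B -> represents B v.
  move=> B; have [MB|nMB] := pselect (Mp B); last by exists 0.
  have [_ [_ _ /perfectP[_ Bs]]] := MB.
  have [u hu] := Bs (pull (pull_op (pband_restr B)) Phi).
  exists (vsub_val u) => _; split; first exact: pband_valP.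
  by move=> psi; rewrite pband_restr_incl -hu pullE.
have [u uE] : exists u, forall B, Mp B -> pband_proj B u = f B.
  apply: (invlim_glue iso) => [B /fP[]//|A B MA MB AB].
  have [fA PhiA] := fP A MA; have [fB PhiB] := fP B MB.
  have [_ [_ _ /perfectP[Ar _]]] := MA.
  rewrite -(pband_proj_id fA) -!pband_restrE; congr vsub_val.
  (* Both vectors of [A] represent [Phi] on functionals pulled back from [A]: for f(B), such a
     functional is first restricted to [B]. *)
  apply: oc_separates Ar _ => psi; rewrite -PhiA.
  have := PhiB (pull (nop_comp (pband_restr A) (pband_incl B)) psi).
  rewrite pullE nop_compE pband_inclE pband_restrE pband_proj_id// => <-.
  congr (vsub_val Phi _); apply: oc_ext => v; rewrite !pullE nop_compE pband_inclE.
  by rewrite pband_restrE; congr (vsub_val psi _); apply: vsub_ext;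
    rewrite !pband_restrE pband_proj_sub.
have PhiE B phi : Mp B -> vsub_val Phi (restr_to B phi) = vsub_val (restr_to B phi) u.
  move=> MB; have [_ PhiB] := fP B MB.
  have := PhiB (pull (pband_incl B) phi).
  rewrite pullE pband_inclE pband_restrE -(uE _ MB).
  rewrite (pband_proj_id (pband_proj_in B u)) -restr_toE => <-.
  congr (vsub_val Phi _); apply: oc_ext => v.
  by rewrite restr_toE !pullE pband_inclE pband_restrE.
have Phi_ge0 phi : 0 <= phi -> vsub_val Phi phi = vsub_val phi u.
  move=> phi0; apply/eqP; rewrite -subr_eq0 -normr_le0.
  apply/ler_addgt0Pl => e e0; rewrite addr0.
  (* The difference of [Phi] and evaluation at [u] kills every phi o P_B, so its value at [phi] is
     its value at phi - phi o P_B, which order continuity makes arbitrarily small. *)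
  have := oc_dualP (Phi - canonical_map u) (restr_to_dec0 phi0).
  move=> /infimums0P/(_ _ e0)[_ [B MB <-] h]; apply: le_trans (ltW h).
  rewrite oc_subE canonical_mapE odualB PhiE// oc_subE opprB addrA subrK.
  by [].
exists u => phi; rewrite -(vposB phi) odualB oc_subE.
by rewrite !Phi_ge0 ?vpos_ge0.
Qed.

End IsoToPerfect.

End Reflexivity.

Theorem corollary6p13 (R : realType) (E : vectorLatticeType R)
    (hE : dedekind_complete E) :
  pband_ideal (perfect_carriers E) /\
  (lattice_isomorphism (proj_invlim (perfect_carriers E)) <-> perfect E).
Proof.
split; first exact: perfect_carriers_ideal.
split=> [iso|]; last exact: perfect_proj_invlim.
apply/perfectP; split; first exact: proj_invlim_reflects.
exact: proj_invlim_reflexive.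
Qed.
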